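(* Fix a finite set $\Gamma$ of colours and consider only graphs whose colours lie in $\Gamma$. Let $k,d\ge 1$. Then there is a finite set $\mathcal F_{k,d}$ of graphs of tree depth at most $k$, computable from $k$ and $d$, such that for all graphs $G,G'$ of maximum degree at most $d$ the following are equivalent. (i) $\hom(F,G)=\hom(F,G')$ for all $F\in\mathcal F_{k,d}$. (ii) $G$ and $G'$ satisfy the same $\mathsf{C}_k$-sentences.
   Context: Graphs are finite, undirected, vertex-coloured triples $(V(G),E(G),\gamma^G)$ with $\gamma^G:V(G)\to\Gamma$. A homomorphism preserves edges and colours; $\hom(F,G)$ counts homomorphisms from $F$ to $G$. A forest is a finite poset $(V,\preceq)$ in which each $\{u:u\preceq t\}$ is a chain; its height is the maximum number of elements of a chain. An elimination forest of a graph $G$ is a forest on $V(G)$ such that $u\preceq v$ or $v\preceq u$ for every edge $uv$. The tree depth of $G$ is the minimum height of an elimination forest of $G$. $\mathsf{C}$ is first-order logic with counting: atomic formulas $x=y$, $E(x,y)$, $\gamma(x)=c$, closed under $\neg$, $\vee$ and counting quantifiers $\exists^{\ge p}x\,\varphi$ (at least $p$ distinct witnesses). Quantifier rank counts nesting depth of counting quantifiers; $\mathsf{C}_k$ consists of formulas of quantifier rank at most $k$. *)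

(* Defs.v *)
From HB Require Import structures.
From mathcomp Require Import all_boot.

Set Implicit Arguments.
Unset Strict Implicit.
Unset Printing Implicit Defensive.

Record cgraph (Gamma : finType) := CGraph {
  vertex :> finType;
  edge : rel vertex;
  colour : vertex -> Gamma;
  edge_sym : symmetric edge;
  edge_irr : irreflexive edge
}.

Arguments edge {Gamma} c _ _.
Arguments colour {Gamma} c _.

Definition is_hom (Gamma : finType) (F G : cgraph Gamma) (f : {ffun F -> G}) :
    bool :=
  [forall u, forall v, edge F u v ==> edge G (f u) (f v)] &&
  [forall u, colour G (f u) == colour F u].

Definition hom (Gamma : finType) (F G : cgraph Gamma) : nat :=
  #|[set f : {ffun F -> G} | is_hom f]|.

Definition max_degree (Gamma : finType) (G : cgraph Gamma) : nat :=
  \max_(v : G) #|[set w : G | edge G v w]|.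

Section Forests.
Variable T : finType.
Implicit Type r : rel T.

Definition is_poset r : bool :=
  [&& [forall x, r x x],
      [forall x, forall y, r x y && r y x ==> (x == y)] &
      [forall x, forall y, forall z, r x y && r y z ==> r x z]].

Definition is_chain r (C : {set T}) : bool :=
  [forall x in C, forall y in C, r x y || r y x].

Definition is_forest r : bool :=
  is_poset r && [forall t, is_chain r [set u | r u t]].

Definition height r : nat := \max_(C : {set T} | is_chain r C) #|C|.

(* Relations on T are represented by their graphs, so that the minimum below
   ranges over a finite type. *)
Definition rel_of (R : {set T * T}) : rel T := fun x y => (x, y) \in R.

End Forests.

Section TreeDepth.
Variables (Gamma : finType) (G : cgraph Gamma).

Definition elimination_forest (r : rel G) : bool :=
  is_forest r && [forall u, forall v, edge G u v ==> r u v || r v u].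

Definition elim_height (n : nat) : bool :=
  [exists R : {set G * G},
    elimination_forest (rel_of R) && (height (rel_of R) == n)].

Lemma ex_elim_height : exists n, elim_height n.
Proof.
pose R := [set p : G * G | enum_rank p.1 <= enum_rank p.2].
have RE x y : rel_of R x y = (enum_rank x <= enum_rank y) by rewrite /rel_of inE.
exists (height (rel_of R)); apply/existsP; exists R; rewrite eqxx andbT.
apply/andP; split; last first.
  by apply/forallP=> u; apply/forallP=> v; apply/implyP=> _; rewrite !RE leq_total.
apply/andP; split; last first.
  apply/forallP=> t; apply/forall_inP=> x _; apply/forall_inP=> y _.
  by rewrite !RE leq_total.
apply/and3P; split.
- by apply/forallP=> x; rewrite RE.
- apply/forallP=> x; apply/forallP=> y; apply/implyP; rewrite !RE -eqn_leq.
  by move/eqP/val_inj/enum_rank_inj->.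
- apply/forallP=> x; apply/forallP=> y; apply/forallP=> z.
  by apply/implyP; rewrite !RE => /andP[]; apply: leq_trans.
Qed.

Definition tree_depth : nat := ex_minn ex_elim_height.

End TreeDepth.

Inductive cform (Gamma : Type) : Type :=
| CEq of nat & nat
| CEdge of nat & nat
| CCol of nat & Gamma
| CNot of cform Gamma
| COr of cform Gamma & cform Gamma
| CExGe of nat & nat & cform Gamma. (* CExGe p x phi: at least p values of x *)

Fixpoint free_vars (Gamma : Type) (phi : cform Gamma) : seq nat :=
  match phi with
  | CEq x y | CEdge x y => [:: x; y]
  | CCol x _ => [:: x]
  | CNot psi => free_vars psi
  | COr psi chi => free_vars psi ++ free_vars chi
  | CExGe _ x psi => [seq y <- free_vars psi | y != x]
  end.

Definition sentence (Gamma : Type) (phi : cform Gamma) : bool :=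
  nilp (free_vars phi).

Fixpoint qrank (Gamma : Type) (phi : cform Gamma) : nat :=
  match phi with
  | CEq _ _ | CEdge _ _ | CCol _ _ => 0
  | CNot psi => qrank psi
  | COr psi chi => maxn (qrank psi) (qrank chi)
  | CExGe _ _ psi => (qrank psi).+1
  end.

(* Assignments are partial because a graph may have no vertices. An atom with
   an unassigned variable is false; this never happens inside a sentence. *)
Definition assignment (T : Type) := nat -> option T.

Definition update (T : Type) (a : assignment T) (x : nat) (v : T) :
    assignment T :=
  fun y => if y == x then Some v else a y.

Fixpoint sat (Gamma : finType) (G : cgraph Gamma) (a : assignment G)
    (phi : cform Gamma) : bool :=
  match phi with
  | CEq x y => if (a x, a y) is (Some u, Some v) then u == v else false
  | CEdge x y => if (a x, a y) is (Some u, Some v) then edge G u v else false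
  | CCol x c => if a x is Some u then colour G u == c else false
  | CNot psi => ~~ sat a psi
  | COr psi chi => sat a psi || sat a chi
  | CExGe p x psi => p <= #|[set v : G | sat (update a x v) psi]|
  end.

Definition models (Gamma : finType) (G : cgraph Gamma) (phi : cform Gamma) :
    bool :=
  sat (fun _ => None : option G) phi.

Definition C_equiv (Gamma : finType) (k : nat) (G G' : cgraph Gamma) : Prop :=
  forall phi : cform Gamma, sentence phi -> qrank phi <= k ->
    models G phi = models G' phi.

(* Partial recursive functions (Kleene). Arities are not tracked: a term applied
   to an argument list of the wrong length may have no value. *)
Inductive recfun : Type :=
| RZero
| RSucc
| RProj of nat
| RComp of recfun & seq recfun
| RPrec of recfun & recfun
| RMin of recfun.

Inductive reval : recfun -> seq nat -> nat -> Prop :=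
| reval_zero v : reval RZero v 0
| reval_succ n : reval RSucc [:: n] n.+1
| reval_proj i v : i < size v -> reval (RProj i) v (nth 0 v i)
| reval_comp f gs v ws m :
    revals gs v ws -> reval f ws m -> reval (RComp f gs) v m
| reval_prec0 f g v m : reval f v m -> reval (RPrec f g) (0 :: v) m
| reval_precS f g n v m m' :
    reval (RPrec f g) (n :: v) m -> reval g (n :: m :: v) m' ->
    reval (RPrec f g) (n.+1 :: v) m'
| reval_min f n v :
    (forall i, i < n -> exists m, reval f (i :: v) m.+1) ->
    reval f (n :: v) 0 -> reval (RMin f) v n
with revals : seq recfun -> seq nat -> seq nat -> Prop :=
| revals_nil v : revals [::] v [::]
| revals_cons g gs v m ms :
    reval g v m -> revals gs v ms -> revals (g :: gs) v (m :: ms).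

Definition computable2 (f : nat -> nat -> nat) : Prop :=
  exists e : recfun, forall m n, reval e [:: m; n] (f m n).

(* The number of vertices, the colour of each vertex, and the adjacency matrix
   row by row, with vertices and colours listed in the order of [enum]. The
   code determines the graph up to isomorphism. *)
Definition code_graph (Gamma : finType) (G : cgraph Gamma) : nat :=
  CodeSeq.code
    (#|G| :: [seq nat_of_ord (enum_rank (colour G v)) | v <- enum G]
          ++ [seq nat_of_bool (edge G u v) | u <- enum G, v <- enum G]).

Definition code_graphs (Gamma : finType) (s : seq (cgraph Gamma)) : nat :=
  CodeSeq.code [seq code_graph G | G <- s].

(* Main.v *)
Require Import Defs.
From HB Require Import structures.
From mathcomp Require Import all_boot.
From mathcomp Require Import ssralg ssrint.

Set Implicit Arguments.
Unset Strict Implicit.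
Unset Printing Implicit Defensive.

(** A graph of tree depth at most [k] is described by a term recording, for
    every node of an elimination tree, its colour and the levels of its
    neighbours above it; homomorphism counts are then nested sums of products
    along the tree. "The count of [t] is [m]" is expressible with as many nested
    counting quantifiers as [t] has levels, so C_k-equivalent graphs have equal
    counts. Conversely, counts are closed under products, so interpolation
    recovers from them how many vertices extend a tuple in each possible way,
    which is the winning condition of the counting game; vertices repeated in the
    tuple are removed by identifying two levels of a term.

    The degree bound makes finitely many terms suffice. Every count is a product
    of counts of connected terms, and for a connected term attached to a vertex
    [v] only the at most [(d+1)^(2^k)] vertices near [v] contribute. Hence
    interpolation needs bounded branching below the root, and at the root only
    boundedly many value vectors occur.

    The family consists of all colourings and all ancestor-descendant edge sets on
    the complete [b]-ary tree of height [k], for a suitable [b]. Superfluous nodes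
    of the tree become isolated vertices with the colour of the root, which
    multiply the count by a power of the number of vertices of that colour. *)

(** * Interpolation *)

Section Separation.

Import GRing.Theory.
Local Open Scope ring_scope.

(** Expanding one factor [x_a - Y_a] leaves a sum whose monomial has grown by [a] and a constant
    multiple of the old sum. [L] collects the coordinates chosen so far, so the budget to watch is
    [size L + size Ys]. *)
Lemma sum_separating_product (n M : nat) (S S' : seq (seq nat)) (L0 : seq nat)
    (dI : seq nat -> nat) :
  (forall L, all (gtn n) L -> (size L <= M)%N ->
     (\sum_(x <- S) \prod_(a <- L0 ++ L) nth 0 x a =
      \sum_(x <- S') \prod_(a <- L0 ++ L) nth 0 x a)%N) ->
  forall Ys L, all (fun Y => dI Y < n)%N Ys -> all (gtn n) L ->
  (size L + size Ys <= M)%N ->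
  \sum_(x <- S) (\prod_(a <- L0 ++ L) nth 0 x a)%N%:Z *
     \prod_(Y <- Ys) ((nth 0%N x (dI Y))%:Z - (nth 0%N Y (dI Y))%:Z) =
  \sum_(x <- S') (\prod_(a <- L0 ++ L) nth 0 x a)%N%:Z *
     \prod_(Y <- Ys) ((nth 0%N x (dI Y))%:Z - (nth 0%N Y (dI Y))%:Z).
Proof.
move=> eqS; elim=> [|Y Ys IH] L /= dIY Ln sz.
  rewrite (eq_bigr (fun x => (\prod_(a <- L0 ++ L) nth 0 x a)%N%:Z)); last first.
    by move=> x _; rewrite big_nil mulr1.
  rewrite [RHS](eq_bigr (fun x => (\prod_(a <- L0 ++ L) nth 0 x a)%N%:Z)).
    by rewrite -!(big_morph Posz PoszD (erefl _)) eqS // -(addn0 (size L)).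
  by move=> x _; rewrite big_nil mulr1.
case/andP: dIY => dY dYs.
have step (T : seq (seq nat)) :
  \sum_(x <- T) (\prod_(a <- L0 ++ L) nth 0 x a)%N%:Z *
     \prod_(Y0 <- Y :: Ys) ((nth 0%N x (dI Y0))%:Z - (nth 0%N Y0 (dI Y0))%:Z) =
  \sum_(x <- T) (\prod_(a <- L0 ++ (dI Y :: L)) nth 0 x a)%N%:Z *
     \prod_(Y0 <- Ys) ((nth 0%N x (dI Y0))%:Z - (nth 0%N Y0 (dI Y0))%:Z)
  - (nth 0%N Y (dI Y))%:Z *
  \sum_(x <- T) (\prod_(a <- L0 ++ L) nth 0 x a)%N%:Z *
     \prod_(Y0 <- Ys) ((nth 0%N x (dI Y0))%:Z - (nth 0%N Y0 (dI Y0))%:Z).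
  rewrite mulr_sumr -sumrB; apply: eq_bigr => x _.
  rewrite big_cons mulrA mulrBr mulrBl; congr (_ - _).
    congr (_ * _); rewrite -PoszM; congr Posz.
    by rewrite !big_cat big_cons /= mulnCA mulnC.
  by rewrite [_ * (nth 0%N Y _)%:Z]mulrC mulrA.
have dL : all (gtn n) (dI Y :: L) by apply/andP.
rewrite !step (IH (dI Y :: L)) ?(IH L) //; last by rewrite /= addSnnS.
by apply: leq_trans sz; rewrite leq_add2l.
Qed.

(* A family of vectors is determined by its monomial sums: for each vector [X]
   a product of at most [M] factors [x_a - Y_a] vanishes at all the other
   vectors [Y] but not at [X]. The monomial [L0] is a weight. *)
Lemma perm_eq_monomial_sums (n M : nat) (S S' : seq (seq nat)) (L0 : seq nat) :
  all (fun x => size x == n) (S ++ S') ->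
  (size (undup (S ++ S')) <= M)%N ->
  all (fun x => 0 < \prod_(a <- L0) nth 0 x a)%N (S ++ S') ->
  (forall L, all (gtn n) L -> (size L <= M)%N ->
     (\sum_(x <- S) \prod_(a <- L0 ++ L) nth 0 x a =
      \sum_(x <- S') \prod_(a <- L0 ++ L) nth 0 x a)%N) ->
  perm_eq S S'.
Proof.
move=> szn szM pos eqS; apply/allP => X XSS /=.
pose dI Y := find (fun a => nth 0%N X a != nth 0%N Y a) (iota 0 n).
have dIP Y : Y \in S ++ S' -> Y != X -> (dI Y < n)%N /\ nth 0%N X (dI Y) != nth 0%N Y (dI Y).
  move=> YS YX; have hasY : has (fun a => nth 0%N X a != nth 0%N Y a) (iota 0 n).
    apply: contraNT YX => /hasPn eqXY.
    have /eqP sX := allP szn _ XSS; have /eqP sY := allP szn _ YS.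
    apply/eqP/(@eq_from_nth _ 0%N); first by rewrite sX sY.
    move=> a; rewrite sY => an.
    have an0 : a \in iota 0 n by rewrite mem_iota.
    by have := eqXY _ an0; rewrite negbK => /eqP.
  have lt := hasY; rewrite has_find size_iota in lt; split=> //.
  by have := nth_find 0%N hasY; rewrite -/(dI Y) nth_iota // add0n.
pose Ys := [seq Y <- undup (S ++ S') | Y != X].
have YsP Y : Y \in Ys = (Y != X) && (Y \in S ++ S') by rewrite mem_filter mem_undup.
have dYs : all (fun Y => dI Y < n)%N Ys.
  by apply/allP=> Y; rewrite YsP => /andP[YX /dIP/(_ YX)[]].
have sYs : (size ([::] : seq nat) + size Ys <= M)%N.
  by apply: leq_trans szM; rewrite size_filter count_size.
have := sum_separating_product eqS dYs (isT : all _ [::]) sYs; rewrite cats0.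
pose w : int := (\prod_(a <- L0) nth 0 X a)%N%:Z *
     \prod_(Y <- Ys) ((nth 0%N X (dI Y))%:Z - (nth 0%N Y (dI Y))%:Z).
have w0 : w != 0.
  rewrite mulf_neq0 //; first by have := allP pos _ XSS; rewrite lt0n.
  rewrite prodf_seq_neq0; apply/allP => Y; rewrite YsP => /andP[YX /dIP/(_ YX)[_ neq]].
  by rewrite /= subr_eq0.
have sumE (T : seq (seq nat)) : {subset T <= S ++ S'} ->
   \sum_(x <- T) (\prod_(a <- L0) nth 0 x a)%N%:Z *
     \prod_(Y <- Ys) ((nth 0%N x (dI Y))%:Z - (nth 0%N Y (dI Y))%:Z)
   = w *+ count_mem X T.
  elim: T => [|x T IH] sub; first by rewrite big_nil.
  rewrite big_cons IH /=; last by move=> y yT; apply: sub; rewrite inE yT orbT.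
  have [->|xX] := eqVneq x X; first by rewrite mulrS.
  rewrite add0n; set p := \prod_(Y <- Ys) _; suff -> : p = 0 by rewrite mulr0 add0r.
  have xYs : x \in Ys by rewrite YsP xX sub // mem_head.
  by rewrite /p (big_rem x) //= subrr mul0r.
have subS : {subset S <= S ++ S'} by move=> x xS; rewrite mem_cat xS.
have subS' : {subset S' <= S ++ S'} by move=> x xS; rewrite mem_cat xS orbT.
rewrite (sumE _ subS) (sumE _ subS'); move: (count_mem X S) (count_mem X S') => p q.
move=> wpq; have : w * (p%:Z - q%:Z) == 0.
  by rewrite mulrBr -!natz !mulr_natr wpq subrr.
by rewrite mulf_eq0 (negPf w0) orFb subr_eq0.
Qed.

End Separation.

(** The first hypothesis compares elements of [W] with elements of [W'], never two of the same
    family. So elements are matched off one at a time, without making [t] a function of [s]. *)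
Lemma perm_map_transfer (X X' : eqType) (R R' : eqType) (s : X -> R) (s' : X' -> R)
    (t : X -> R') (t' : X' -> R') (W : seq X) (W' : seq X') :
  (forall x x', x \in W -> x' \in W' -> s x = s' x' -> t x = t' x') ->
  perm_eq (map s W) (map s' W') -> perm_eq (map t W) (map t' W').
Proof.
elim: W W' => [|x W IH] W' tt.
  by rewrite perm_sym => /perm_nilP/(congr1 size); rewrite size_map; case: W' tt.
move=> pW; have /mapP[x' x'W sx] : s x \in map s' W'.
  by rewrite -(perm_mem pW) mem_head.
have pW' := perm_to_rem x'W.
rewrite perm_sym (perm_trans (perm_map t' pW')) //= perm_sym.
rewrite (tt x x') ?mem_head // perm_cons; apply: IH.
  by move=> y y' yW /mem_rem y'W; apply: tt; rewrite // inE yW orbT.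
rewrite -(perm_cons (s x)) /=; apply: perm_trans pW _.
by rewrite sx (perm_map s' pW').
Qed.

(** The form in which interpolation is applied: coordinates are functions indexed by [D], and [L0]
    is a weight positive on both families. *)
Lemma perm_eq_value_sums (J X X' : eqType) (D : seq J) (f : J -> X -> nat)
    (f' : J -> X' -> nat) (L0 : seq J) (W : seq X) (W' : seq X') (M : nat) :
  let sig x := [seq f j x | j <- D] in
  let sig' x := [seq f' j x | j <- D] in
  {subset L0 <= D} ->
  size (undup (map sig W ++ map sig' W')) <= M ->
  (forall x, x \in W -> 0 < \prod_(j <- L0) f j x) ->
  (forall x, x \in W' -> 0 < \prod_(j <- L0) f' j x) ->
  (forall L, {subset L <= D} -> size L <= M ->
     \sum_(x <- W) \prod_(j <- L0 ++ L) f j x =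
     \sum_(x <- W') \prod_(j <- L0 ++ L) f' j x) ->
  perm_eq (map sig W) (map sig' W').
Proof.
move=> sig sig' L0D szM pos pos' eqS.
have nthsig x j : j \in D -> nth 0 (sig x) (index j D) = f j x.
  by move=> jD; rewrite (nth_map j) ?index_mem // nth_index.
have nthsig' x j : j \in D -> nth 0 (sig' x) (index j D) = f' j x.
  by move=> jD; rewrite (nth_map j) ?index_mem // nth_index.
have prodsig (L : seq J) x : {subset L <= D} ->
    \prod_(a <- map (index^~ D) L) nth 0 (sig x) a = \prod_(j <- L) f j x.
  by move=> LD; rewrite big_map !big_seq; apply: eq_bigr => j /LD; exact: nthsig.
have prodsig' (L : seq J) x : {subset L <= D} ->
    \prod_(a <- map (index^~ D) L) nth 0 (sig' x) a = \prod_(j <- L) f' j x.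
  by move=> LD; rewrite big_map !big_seq; apply: eq_bigr => j /LD; exact: nthsig'.
apply: (@perm_eq_monomial_sums (size D) M _ _ (map (index^~ D) L0)) => //.
- by rewrite all_cat; apply/andP; split; apply/allP => _ /mapP[x _ ->]; rewrite size_map.
- rewrite all_cat; apply/andP; split; apply/allP => _ /mapP[x xW ->].
    by rewrite prodsig ?pos.
  by rewrite prodsig' ?pos'.
(* An empty [D] offers no default for reading positions back as functions, but then [L] is empty
   too. *)
move=> L /allP Ln szL; have [D0|] := posnP (size D).
  have L_nil : L = [::] by case: L Ln {szL} => // a L /(_ a (mem_head _ _)); rewrite D0.
  have := eqS [::]; rewrite L_nil !cats0 => /(_ (fun _ => False_ind _ \o notF) (leq0n _)) eq0.
  rewrite !big_map; under eq_bigr do rewrite prodsig //.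
  by rewrite eq0; apply: eq_bigr => x _; rewrite prodsig'.
case ED: D => [//|j0 D'] _; rewrite -ED.
have uLD : {subset [seq nth j0 D a | a <- L] <= D}.
  by move=> _ /mapP[a /Ln aD ->]; rewrite mem_nth.
have := eqS _ uLD; rewrite size_map => /(_ szL) E.
have cvt (T : Type) (g : J -> T -> nat) x :
   \prod_(a <- map (index^~ D) L0 ++ L) nth 0 [seq g j x | j <- D] a =
   \prod_(j <- L0 ++ [seq nth j0 D a | a <- L]) g j x.
  rewrite !big_cat /= !big_map; congr (_ * _).
    rewrite !big_seq; apply: eq_bigr => j /L0D jD.
    by rewrite (nth_map j) ?index_mem // nth_index.
  by rewrite !big_seq; apply: eq_bigr => a /Ln aD; rewrite (nth_map j0).
rewrite !big_map; under eq_bigr do rewrite cvt.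
by rewrite E; apply: eq_bigr => x _; rewrite cvt.
Qed.

(** * Terms *)

(* [Node c A ch] is a rooted graph given with an elimination tree: the root has
   colour [c], and its neighbours above it are the ancestors at the levels in
   [A], where level 0 is the top of the tree. *)
Inductive tm (Gamma : Type) : Type := Node of Gamma & seq nat & seq (tm Gamma).

Section TermEquality.
Variable Gamma : finType.

Fixpoint tm_encode (t : tm Gamma) : GenTree.tree (Gamma * seq nat) :=
  let: Node c A ch := t in
  GenTree.Node 0 (GenTree.Leaf (c, A) :: map tm_encode ch).

Fixpoint tm_decode (t : GenTree.tree (Gamma * seq nat)) : option (tm Gamma) :=
  match t with
  | GenTree.Node _ (GenTree.Leaf p :: s) => Some (Node p.1 p.2 (pmap tm_decode s))
  | _ => None
  end.

Lemma tm_encodeK : pcancel tm_encode tm_decode.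
Proof.
rewrite /pcancel; fix IH 1; case=> c A ch /=; congr (Some (Node _ _ _)).
by elim: ch => //= t ch ->; rewrite IH.
Qed.

HB.instance Definition _ := Equality.copy (tm Gamma) (pcan_type tm_encodeK).

End TermEquality.

Section Terms.
Variable Gamma : finType.
Implicit Types (t D : tm Gamma) (G : cgraph Gamma) (A : seq nat).

(* The default value of [nth] makes the test fail at levels outside [ctx],
   because [edge] is irreflexive. *)
Definition root_ok G (c : Gamma) A (ctx : seq G) (w : G) : bool :=
  (colour G w == c) && all (fun l => edge G w (nth w ctx l)) A.

Fixpoint thom G t (ctx : seq G) : nat :=
  let: Node c A ch := t in
  \sum_(w : G | root_ok c A ctx w)
     foldr (fun D m => thom D (rcons ctx w) * m) 1 ch.

Lemma thomE G c A ch (ctx : seq G) :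
  thom (Node c A ch) ctx =
  \sum_(w : G | root_ok c A ctx w) \prod_(D <- ch) thom D (rcons ctx w).
Proof.
rewrite /=; apply: eq_bigr => w _.
by elim: ch => [|D ch /= ->]; rewrite ?big_nil ?big_cons.
Qed.

(** An increasing, duplicate-free normal form for sets of levels; it leaves only finitely many
    well-formed terms. *)
Definition canon (i : nat) A : seq nat := [seq l <- iota 0 i | l \in A].

(** [n] bounds the branching, [j] the height, and [i] is the number of levels already above the
    root. *)
Fixpoint wf (n j i : nat) t : bool :=
  if j is j'.+1 then
    let: Node c A ch := t in
    [&& A == canon i A, size ch <= n & all (wf n j' i.+1) ch]
  else false.

Lemma wf_leq n n' j j' i t : n <= n' -> j <= j' -> wf n j i t -> wf n' j' i t.
Proof.
move=> nn'; elim: j j' i t => // j IH [//|j'] i [c A ch] jj' /= /and3P[-> sz /allP wch].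
rewrite (leq_trans sz nn') /=; apply/allP => D /wch; exact: IH.
Qed.

Lemma canonK i A : canon i (canon i A) = canon i A.
Proof.
by apply: eq_in_filter => l li; rewrite mem_filter li andbT.
Qed.

Lemma mem_canon i A l : (l \in canon i A) = (l < i) && (l \in A).
Proof. by rewrite mem_filter mem_iota andbC. Qed.

Lemma canon_lt i A l : A == canon i A -> l \in A -> l < i.
Proof. by move/eqP->; rewrite mem_canon => /andP[]. Qed.

Fixpoint seqs_le (T : Type) (n : nat) (s : seq T) : seq (seq T) :=
  if n is n'.+1 then
    [::] :: [seq x :: l | x <- s, l <- seqs_le n' s]
  else [:: [::]].

Lemma mem_seqs_le (T : eqType) n (s l : seq T) :
  (l \in seqs_le n s) = (size l <= n) && all (mem s) l.
Proof.
elim: n l => [|n IH] [|x l] //=; rewrite inE /= ltnS.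
apply/allpairsP/and3P=> [[[y m] /= [ys ms [-> ->]]]|[sz xs al]].
  by move: ms; rewrite IH => /andP[].
by exists (x, l); split; rewrite //= IH sz.
Qed.

Lemma size_seqs_le (T : Type) n (s : seq T) : size (seqs_le n s) <= (size s).+1 ^ n.
Proof.
elim: n => //= n IH; rewrite size_allpairs expnS mulSn -add1n.
by rewrite leq_add ?leq_mul // expn_gt0.
Qed.

Fixpoint terms (n j i : nat) : seq (tm Gamma) :=
  if j is j'.+1 then
    [seq Node p.1 p.2 ch | p <- [seq (c, A) | c <- enum Gamma,
                                              A <- map (canon i) (seqs_le i (iota 0 i))],
                           ch <- seqs_le n (terms n j' i.+1)]
  else [::].

Lemma mem_terms n j i t : (t \in terms n j i) = wf n j i t.
Proof.
elim: j i t => // j IH i [c A ch]; apply/allpairsP/idP => /=.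
  case=> [[[c' A'] ch'] /= [/allpairsP[[c2 A2] /= [_ /mapP[B _ ->] [_ ->]]] + [_ -> ->]]].
  rewrite canonK eqxx mem_seqs_le => /andP[-> /allP al] /=.
  by apply/allP=> D /al; rewrite /= IH.
case/and3P=> /eqP EA sz /allP al; exists ((c, A), ch); split=> //=.
  apply/allpairsP; exists (c, A); split; rewrite ?mem_enum //=.
  apply/mapP; exists A; rewrite // mem_seqs_le; apply/andP; split.
    by rewrite EA size_filter (leq_trans (count_size _ _)) ?size_iota.
  by apply/allP=> l; rewrite EA mem_filter => /andP[].
by rewrite mem_seqs_le sz; apply/allP=> D /al; rewrite /= IH.
Qed.

(** At most [k] levels lie above any node, so [k.+1 ^ k] bounds the number of level sets uniformly
    in the depth. *)
Fixpoint terms_bound (g n k j : nat) : nat :=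
  if j is j'.+1 then g * k.+1 ^ k * (terms_bound g n k j').+1 ^ n else 0.

Lemma size_terms n j i k : i + j <= k.+1 ->
  size (terms n j i) <= terms_bound #|Gamma| n k j.
Proof.
elim: j i => //= j IH i ij; rewrite !size_allpairs size_map -cardE.
have /IH sz : i.+1 + j <= k.+1 by rewrite addSnnS.
rewrite !leq_mul //.
  apply: leq_trans (size_seqs_le _ _) _; rewrite size_iota.
  have ik : i <= k by rewrite -ltnS (leq_trans _ ij) // addnS ltnS leq_addr.
  apply: (@leq_trans (i.+1 ^ k)); first by rewrite leq_pexp2l.
  by case: (k) ik => // k' ik; rewrite leq_exp2r.
by apply: leq_trans (size_seqs_le _ _) _; case: n sz {IH} => // n sz; rewrite leq_exp2r.
Qed.

Fixpoint touch (l : nat) t : bool :=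
  let: Node c A ch := t in (l \in A) || has (touch l) ch.

(* Identifies level [i] with level [b] and closes the gap left by level [i]. *)
Definition drop_level (i b l : nat) : nat :=
  if l == i then b else if l < i then l else l.-1.

(** [m] is the number of levels above the root once level [i] is gone. Renormalising merges the two
    entries that arise when a node is adjacent to both identified levels. *)
Fixpoint rename (i b m : nat) t : tm Gamma :=
  let: Node c A ch := t in
  Node c (canon m (map (drop_level i b) A)) (map (rename i b m.+1) ch).

Lemma wf_rename n j i b m t : wf n j m.+1 t -> wf n j m (rename i b m t).
Proof.
elim: j m t => // j IH m [c A ch] /= /and3P[_ sz /allP wch].
rewrite canonK eqxx size_map sz /=; apply/allP=> _ /mapP[D /wch wD ->]; exact: IH.
Qed.

Lemma touch_rename n j i b m t l : i <= m -> wf n j m.+1 t -> l <= m -> l != i ->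
  touch l t -> touch (drop_level i b l) (rename i b m t).
Proof.
elim: j m t => // j IH m [c A ch] im /= /and3P[/eqP EA sz /allP wch] lm li.
case/orP => [lA|/hasP[D Dch tD]]; apply/orP; [left|right].
  rewrite mem_canon map_f // andbT /drop_level (negPf li).
  case: (ltngtP l i) li => // [lt|gt] _; first exact: leq_trans lt im.
  by rewrite prednK ?(leq_trans _ gt).
rewrite has_map; apply/hasP; exists D => //=.
by apply: IH => //; [exact: ltnW | exact: wch | exact: ltnW].
Qed.

(** Edges to [v] at level [size c0] are read off at level [b] instead, so [b] must hold [v] as well;
    if the term never touches that level, [b] is arbitrary. The first case serves repeated vertices
    in the game, the second serves moving a subterm out from below its root. *)
Lemma thom_rename n j G (c0 e : seq G) (v : G) b t :
  wf n j (size c0 + size e).+1 t ->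
  (touch (size c0) t -> b < size c0 /\ nth v c0 b = v) ->
  thom (rename (size c0) b (size c0 + size e) t) (c0 ++ e) =
  thom t (c0 ++ v :: e).
Proof.
elim: j e t => // j IH e [c A ch] /= /and3P[/eqP EA sz /allP wch] tb.
rewrite -!/(thom (Node _ _ _) _) -[LHS]/(thom (Node _ _ _) _) !thomE.
apply: eq_big => [w|w _].
  congr (_ && _).
  have E l : l \in A -> nth w (c0 ++ e) (drop_level (size c0) b l) = nth w (c0 ++ v :: e) l
        /\ drop_level (size c0) b l < size c0 + size e.
    move=> lA; rewrite /drop_level; have [E|neq] := eqVneq l (size c0).
      have [|lt nv] := tb; first by rewrite -E lA.
      rewrite !nth_cat lt E ltnn subnn /= (set_nth_default v) // nv; split=> //.
      exact: ltn_addr.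
    have := mem_canon (size c0 + size e).+1 A l; rewrite -EA lA andbT => /esym ll.
    case: (ltngtP l (size c0)) neq => // lc _; first by rewrite !nth_cat lc ltn_addr.
    case: l lc {lA} ll => // l; rewrite ltnS => lc ll /=.
    by split=> //; rewrite !nth_cat !(ltnNge _ (size c0)) lc leqW //= subSn.
  apply/allP/allP => aA l.
    by move=> lA; have [<- lt] := E l lA; apply: aA; rewrite mem_canon lt map_f.
  rewrite mem_canon => /andP[_ /mapP[l' lA ->]].
  by have [-> _] := E l' lA; apply: aA.
rewrite big_map !big_seq; apply: eq_bigr => D Dch.
rewrite !rcons_cat /=; have := IH (rcons e w) D; rewrite size_rcons addnS; apply.
  exact: wch.
by move=> tD; apply: tb; apply/orP; right; apply/hasP; exists D.
Qed.

Lemma thom_rename_last n j G (ctx : seq G) (v : G) b t :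
  wf n j (size ctx).+1 t ->
  (touch (size ctx) t -> b < size ctx /\ nth v ctx b = v) ->
  thom (rename (size ctx) b (size ctx) t) ctx = thom t (rcons ctx v).
Proof.
move=> wt tb; have := @thom_rename n j G ctx [::] v b t.
by rewrite addn0 cats0 cats1; apply.
Qed.

End Terms.

(** * Definability of homomorphism counts *)

Lemma sat_ext (Gamma : finType) (G : cgraph Gamma) (phi : cform Gamma)
    (a a' : assignment G) : a =1 a' -> sat a phi = sat a' phi.
Proof.
elim: phi a a' => [x y|x y|x c|psi IH|psi IH chi IH'|p x psi IH] a a' aa' /=.
- by rewrite !aa'.
- by rewrite !aa'.
- by rewrite !aa'.
- by rewrite (IH a a').
- by rewrite (IH a a') // (IH' a a').
congr (_ <= _); apply: eq_card => v; rewrite !inE; apply: IH => y.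
by rewrite /update aa'.
Qed.

Lemma onth_rcons (T : Type) (s : seq T) x l :
  onth (rcons s x) l = if l == size s then Some x else onth s l.
Proof. by elim: s l => [|y s IH] [|l] //=; rewrite ?IH // !onth_default. Qed.

Lemma onth_lt (T : Type) (x : T) (s : seq T) l :
  l < size s -> onth s l = Some (nth x s l).
Proof. by elim: s l => [|y s IH] [|l] //= /IH. Qed.

Section Definability.
Variable Gamma : finType.

Section Closure.
Variables (X : cgraph Gamma -> Type) (env : forall G, X G -> seq G).
Variables (j i : nat).

(** One formula has to serve all graphs, with variable [l] denoting entry [l] of the tuple.
    Abstracting over [X] and [env] covers both plain tuples and tuples with a separate last vertex,
    the situation under a quantifier. *)
Definition definable (P : forall G, X G -> bool) : Prop :=
  exists phi : cform Gamma,
    [/\ qrank phi <= j, all (gtn i) (free_vars phi) &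
        forall G (x : X G), size (env x) = i -> sat (onth (env x)) phi = P G x].

Definition definable_nat (h : forall G, X G -> nat) : Prop :=
  forall m, definable (fun G x => h G x == m).

Lemma definable_ext (P Q : forall G, X G -> bool) :
  (forall G (x : X G), size (env x) = i -> P G x = Q G x) ->
  definable P -> definable Q.
Proof.
move=> PQ [phi [qr fv sP]]; exists phi; split=> // G x sx; by rewrite sP // PQ.
Qed.

Lemma definable_not P : definable P -> definable (fun G x => ~~ P G x).
Proof. by case=> phi [qr fv sP]; exists (CNot phi); split=> //= G x sx; rewrite sP. Qed.

Lemma definable_or P Q :
  definable P -> definable Q -> definable (fun G x => P G x || Q G x).
Proof.
case=> phi [qr fv sP] [psi [qr' fv' sQ]]; exists (COr phi psi); split=> /=.
- by rewrite geq_max qr.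
- by rewrite all_cat fv.
by move=> G x sx; rewrite sP ?sQ.
Qed.

Lemma definable_and P Q :
  definable P -> definable Q -> definable (fun G x => P G x && Q G x).
Proof.
move=> dP dQ; apply: definable_ext (definable_not (definable_or (definable_not dP) (definable_not dQ))).
by move=> G x _; rewrite negb_or !negbK.
Qed.

Hypothesis ij0 : 0 < i + j.

(** A formula needs an atom on some variable. If the tuple is empty, a vacuous [CExGe 0] binds one
    at the cost of rank 1; no sentence has rank 0, whence [0 < i + j]. *)
Lemma definable_const b : definable (fun _ _ => b).
Proof.
suff dT : definable (fun _ _ => true).
  case: b; first exact: dT.
  apply: definable_ext (definable_not dT). by [].
rewrite /definable; case: i j ij0 => [|i'] [|j'] // _.
- by exists (CExGe 0 0 (CEq _ 0 0)); split=> // G x _; exact: leq0n.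
- exists (CEq _ 0 0); split=> // G x /=.
  by case: (env x) => // v s _; rewrite /= eqxx.
- exists (CEq _ 0 0); split=> // G x /=.
  by case: (env x) => // v s _; rewrite /= eqxx.
Qed.

Lemma definable_has (I : Type) (s : seq I) (P : I -> forall G, X G -> bool) :
  (forall a, definable (P a)) -> definable (fun G x => has (fun a => P a G x) s).
Proof.
move=> dP; elim: s => [|a s IH] /=; first exact: definable_const.
exact: definable_or.
Qed.

Lemma definable_nat_const n : definable_nat (fun _ _ => n).
Proof. by move=> m; apply: definable_const. Qed.

Lemma definable_nat_bool P : definable P -> definable_nat (fun G x => P G x : nat).
Proof.
move=> dP [|[|m]].
- by apply: definable_ext (definable_not dP) => G x _; case: (P G x).
- by apply: definable_ext dP => G x _; case: (P G x).
- by apply: definable_ext (definable_const false) => G x _; case: (P G x).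
Qed.

Lemma definable_gtn h q : definable_nat h -> definable (fun G x => q < h G x).
Proof.
move=> dh; apply: definable_ext (definable_not (definable_has (iota 0 q.+1) dh)) => G x _.
rewrite ltnNge; congr (~~ _); apply/hasP/idP => [[a + /eqP->]|hq].
  by rewrite mem_iota.
by exists (h G x); rewrite ?mem_iota /=.
Qed.

Lemma definable_add h1 h2 : definable_nat h1 -> definable_nat h2 ->
  definable_nat (fun G x => h1 G x + h2 G x).
Proof.
move=> d1 d2 m.
have dP (a : nat) := definable_and (d1 a) (d2 (m - a)).
apply: definable_ext (definable_has (iota 0 m.+1) dP) => G x _.
apply/hasP/eqP => [[a + /andP[/eqP-> /eqP->]]|<-].
  by rewrite mem_iota /= add0n ltnS => am; rewrite subnKC.
by exists (h1 G x); rewrite ?mem_iota /= ?add0n ?ltnS ?leq_addr // addKn !eqxx.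
Qed.

Lemma definable_mul h1 h2 : definable_nat h1 -> definable_nat h2 ->
  definable_nat (fun G x => h1 G x * h2 G x).
Proof.
(* Infinitely many pairs have product 0, so that case is separate; for positive [m] both factors are
   at most [m] and a finite disjunction suffices. *)
move=> d1 d2 m; case: (posnP m) => [->|m0].
  by apply: definable_ext (definable_or (d1 0) (d2 0)) => G x _; rewrite muln_eq0.
have dP (p : nat * nat) := definable_and (d1 p.1) (d2 p.2).
pose s := [seq p <- [seq (a, b) | a <- iota 0 m.+1, b <- iota 0 m.+1] | p.1 * p.2 == m].
apply: definable_ext (definable_has s dP) => G x _.
apply/hasP/eqP => [[[a b] + /andP[/eqP-> /eqP->]]|E].
  by rewrite mem_filter /= => /andP[/eqP].
exists (h1 G x, h2 G x); rewrite /= ?eqxx // mem_filter; apply/andP; split; first by rewrite /= E.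
move: m0; rewrite -E muln_gt0 => /andP[p1 p2].
by apply/allpairsP; exists (h1 G x, h2 G x); rewrite !mem_iota !ltnS leq_pmulr ?leq_pmull.
Qed.

Lemma definable_prod (I : eqType) (s : seq I) (h : I -> forall G, X G -> nat) :
  (forall a, a \in s -> definable_nat (h a)) ->
  definable_nat (fun G x => \prod_(a <- s) h a G x).
Proof.
elim: s => [|a s IH] dh m.
  by apply: definable_ext (definable_nat_const 1 m) => G x _; rewrite big_nil.
have dhs : definable_nat (fun G x => \prod_(a <- s) h a G x).
  by apply: IH => b bs; apply: dh; rewrite inE bs orbT.
apply: definable_ext (definable_mul (dh a (mem_head _ _)) dhs m) => G x _.
by rewrite big_cons.
Qed.

End Closure.

Definition ext_env (G : cgraph Gamma) (p : seq G * G) : seq G := rcons p.1 p.2.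
Arguments ext_env : clear implicits.

(** The bound variable is [i], the level of the new vertex, so updating the assignment agrees with
    appending to the tuple. *)
Lemma definable_card j i (P : forall G : cgraph Gamma, seq G * G -> bool) :
  definable ext_env j i.+1 P ->
  definable_nat (fun G (s : seq G) => s) j.+1 i (fun G ctx => #|[set w | P G (ctx, w)]|).
Proof.
case=> phi [qr fv sP] m.
have dge p : definable (fun G (s : seq G) => s) j.+1 i (fun G ctx => p <= #|[set w | P G (ctx, w)]|).
  exists (CExGe p i phi); split=> //.
    apply/allP => y /=; rewrite mem_filter => /andP[yi /(allP fv)] /=.
    by rewrite ltnS leq_eqVlt (negPf yi).
  move=> G ctx sz /=; congr (_ <= _); apply: eq_card => w; rewrite !inE.
  rewrite -sP; last by rewrite size_rcons sz.
  by apply: sat_ext => y; rewrite /update onth_rcons sz.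
apply: definable_ext (definable_and (dge m) (definable_not (dge m.+1))) => G ctx _ /=.
by rewrite -leqNgt -eqn_leq eq_sym.
Qed.

(* [\sum_w g w = m] iff [\sum_w minn (g w) m.+1 = m], and the second sum is
   [\sum_(q <= m) #|{w | q < g w}|]. *)
Lemma definable_sum j i (g : forall G : cgraph Gamma, seq G * G -> nat) :
  definable_nat ext_env j i.+1 g ->
  definable_nat (fun G (s : seq G) => s) j.+1 i (fun G ctx => \sum_w g G (ctx, w)).
Proof.
move=> dg m; have ij1 : 0 < i + j.+1 by rewrite addnS.
have dsum n : definable_nat (fun G (s : seq G) => s) j.+1 i
    (fun G ctx => \sum_(q < n) #|[set w | q < g G (ctx, w)]|).
  elim: n => [|n IH] m'.
    apply: definable_ext (definable_nat_const _ ij1 0 m') => G x _.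
    by rewrite big_ord0.
  have dn : definable ext_env j i.+1 (fun G p => n < g G p) by apply: definable_gtn.
  apply: definable_ext (definable_add ij1 IH (definable_card dn) m') => G x _.
  by rewrite big_ord_recr.
apply: definable_ext (dsum m.+1 m) => G ctx _.
have -> : \sum_(q < m.+1) #|[set w | q < g G (ctx, w)]| = \sum_w minn (g G (ctx, w)) m.+1.
  pose F (q : 'I_m.+1) (w : G) : nat := q < g G (ctx, w).
  transitivity (\sum_q \sum_w F q w).
    apply: eq_bigr => q _; rewrite -sum1_card big_mkcond /=.
    by apply: eq_bigr => w _; rewrite inE /F; case: ifP.
  rewrite exchange_big /F; apply: eq_bigr => w _ /=.
  elim: (m.+1) => [|n IH]; first by rewrite big_ord0 minn0.
  rewrite big_ord_recr /= IH; case: (ltnP n (g G (ctx, w))) => h.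
    by rewrite (minn_idPr h) addn1.
  by rewrite (minn_idPl (leqW h)) addn0.
case: (boolP [exists w, m < g G (ctx, w)]) => [/existsP[w mw]|].
  have big1 : m < \sum_w g G (ctx, w).
    by rewrite (bigD1 w) //= (leq_trans mw) // leq_addr.
  have big2 : m < \sum_w minn (g G (ctx, w)) m.+1.
    by rewrite (bigD1 w) //= (minn_idPr mw) leq_addr.
  by rewrite !gtn_eqF.
rewrite negb_exists => /forallP le; congr (_ == _); apply: eq_bigr => w _.
by apply/minn_idPl/leqW; rewrite leqNgt.
Qed.

(** Only the sum over the images of the root costs a quantifier; the product over the children is a
    Boolean combination. Hence the rank is the height of the term. *)
Lemma definable_thom n j i (t : tm Gamma) :
  wf n j i t -> definable_nat (fun G (s : seq G) => s) j i (fun G ctx => thom t ctx).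
Proof.
elim: j i t => // j IH i [c A ch] /= /and3P[EA _ /allP wch] m.
have i1 : 0 < i.+1 + j by [].
have dcol : definable ext_env j i.+1 (fun G p => colour G p.2 == c).
  exists (CCol i c); split=> //=; first by rewrite ltnS leqnn.
  by move=> G [ctx w]; rewrite /ext_env size_rcons => -[sz] /=; rewrite onth_rcons sz eqxx.
have dA (l : nat) : l \in A -> definable ext_env j i.+1 (fun G p => edge G p.2 (nth p.2 p.1 l)).
  move=> /(canon_lt EA) li; exists (CEdge Gamma i l); split=> //=.
    by rewrite ltnS leqnn ltnS ltnW.
  move=> G [ctx w]; rewrite /ext_env size_rcons => -[sz] /=.
  by rewrite !onth_rcons sz eqxx (ltn_eqF li) (onth_lt w) ?sz.
have dall : definable ext_env j i.+1 (fun G p => all (fun l => edge G p.2 (nth p.2 p.1 l)) A).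
  elim: (A) dA => [|l B IHB] dB; first exact: definable_const.
  apply: definable_and; first by apply: dB; rewrite mem_head.
  by apply: IHB => l' lB; apply: dB; rewrite inE lB orbT.
have dch : definable_nat ext_env j i.+1 (fun G p => \prod_(D <- ch) thom D (ext_env G p)).
  apply: definable_prod => // D /wch /IH dD m'; have [phi [qr fv sP]] := dD m'.
  by exists phi; split=> // G p sz; rewrite sP.
have dg := definable_mul i1 (definable_nat_bool i1 (definable_and dcol dall)) dch.
apply: definable_ext (definable_sum dg m) => G ctx _.
rewrite -/(thom (Node c A ch) ctx) thomE; congr (_ == _); rewrite [RHS]big_mkcond.
by apply: eq_bigr => w _; rewrite mulnbl.
Qed.

Lemma C_equiv_thom n k (t : tm Gamma) (G G' : cgraph Gamma) :
  wf n k 0 t -> C_equiv k G G' -> thom t ([::] : seq G) = thom t ([::] : seq G').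
Proof.
move=> wt eqGG; have [phi [qr fv sP]] := definable_thom wt (thom t ([::] : seq G)).
have sent : sentence phi by rewrite /sentence; case: (free_vars phi) fv.
have mE (H : cgraph Gamma) : models H phi = (thom t ([::] : seq H) == thom t ([::] : seq G)).
  by rewrite -sP //; apply: sat_ext => -[].
by have := eqGG _ sent qr; rewrite !mE eqxx => /esym/eqP->.
Qed.

End Definability.

(** * The counting game *)

Lemma map_eq_nth (T T' R : Type) (h : T -> R) (h' : T' -> R) s s' :
  size s = size s' ->
  (forall l x x', l < size s -> h (nth x s l) = h' (nth x' s' l)) ->
  map h s = map h' s'.
Proof.
elim: s s' => [|x s IH] [|x' s'] //= [sz] hh; congr cons.
  exact: (hh 0 x x').
by apply: IH => // l y y' ls; apply: (hh l.+1).
Qed.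

Lemma onth_pair (T T' : Type) (s : seq T) (s' : seq T') : size s = size s' ->
  forall l, match onth s l, onth s' l with
    | Some u, Some u' => [/\ l < size s, u = nth u s l & u' = nth u' s' l]
    | None, None => True
    | _, _ => False
    end.
Proof.
move=> sz l; have : (onth s l : bool) = onth s' l by rewrite !onthTE sz.
case El: (onth s l) => [u|]; case El': (onth s' l) => [u'|] // _.
split; first by rewrite -onthTE El.
  by rewrite (@onth_nth _ u _ _ _ El).
by rewrite (@onth_nth _ u' _ _ _ El').
Qed.

Lemma card_set_count (T : finType) (P : pred T) : #|[set v | P v]| = count P (enum T).
Proof. by rewrite -sum1dep_card -sum1_count big_enum_cond. Qed.

Lemma perm_enum_cat (T : finType) (s : seq T) : uniq s ->
  perm_eq (enum T) (s ++ [seq w <- enum T | w \notin s]).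
Proof.
move=> us; apply: uniq_perm; first exact: enum_uniq.
  rewrite cat_uniq us filter_uniq ?enum_uniq // andbT /=.
  by apply/hasPn => w; rewrite mem_filter => /andP[].
by move=> w; rewrite mem_cat mem_filter mem_enum andbT orbN.
Qed.

Lemma count_by_colour (T : Type) (Gamma : finType) (f : T -> Gamma) (P : pred T) s :
  count P s = \sum_(c : Gamma) count P [seq w <- s | f w == c].
Proof.
elim: s => [|w s IH] /=; first by rewrite big1.
rewrite IH (bigD1 (f w)) //= [in RHS](bigD1 (f w)) //= eqxx /= addnA; congr (_ + _).
by apply: eq_bigr => c; rewrite eq_sym => /negPf->.
Qed.

Section GameArgument.
Variable Gamma : finType.

(** Equalities are not compared, because the game keeps its tuples duplicate-free. *)
Definition same_atoms (G G' : cgraph Gamma) (s : seq G) (s' : seq G') : Prop :=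
  forall l x x', l < size s ->
    colour G (nth x s l) = colour G' (nth x' s' l) /\
    forall m, m < size s ->
      edge G (nth x s l) (nth x s m) = edge G' (nth x' s' l) (nth x' s' m).

(** Adjacency to earlier vertices and counts of terms below are interpolated together, so that one
    value vector settles both the atoms and the agreement of the extended tuples. *)
Definition root_value (G : cgraph Gamma) (ctx : seq G) (q : nat + tm Gamma) (w : G) : nat :=
  match q with
  | inl l => edge G w (nth w ctx l)
  | inr D => thom D (rcons ctx w)
  end.

Definition root_levels (L : seq (nat + tm Gamma)) : seq nat :=
  pmap (fun q => if q is inl l then Some l else None) L.

Definition root_terms (L : seq (nat + tm Gamma)) : seq (tm Gamma) :=
  pmap (fun q => if q is inr D then Some D else None) L.

Lemma prod_root_value (G : cgraph Gamma) (ctx : seq G) w (L : seq (nat + tm Gamma)) :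
  \prod_(q <- L) root_value ctx q w =
  all (fun l => edge G w (nth w ctx l)) (root_levels L) *
  \prod_(D <- root_terms L) thom D (rcons ctx w).
Proof.
elim: L => [|[l|D] L IH]; rewrite ?big_nil //= big_cons IH /=.
  by rewrite mulnA mulnb.
by rewrite big_cons mulnCA.
Qed.

Definition root_functions (n j i : nat) : seq (nat + tm Gamma) :=
  map inl (iota 0 i) ++ map inr (terms Gamma n j i.+1).

Lemma mem_root_functions n j i q :
  (q \in root_functions n j i) =
  match q with inl l => l < i | inr D => wf n j i.+1 D end.
Proof.
rewrite mem_cat; case: q => [l|D].
  rewrite mem_map ?mem_iota; last by move=> ? ? [].
  rewrite add0n /=; apply/orP/idP => [[//|/mapP[]//]|->]; by left.
rewrite orbC mem_map ?mem_terms; last by move=> ? ? [].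
apply/orP/idP => [[//|/mapP[]//]|->]; by left.
Qed.

(** Monomial sums over a colour class are themselves counts: the levels in [L] become the edges of
    the root and the terms in [L] its children. Repeated levels are harmless, as indicators are
    idempotent. *)
Lemma thom_root_functions n j (G : cgraph Gamma) (ctx : seq G) c (L : seq (nat + tm Gamma)) :
  {subset L <= root_functions n j (size ctx)} -> size L <= n ->
  exists2 t, wf n j.+1 (size ctx) t &
    forall (H : cgraph Gamma) (s : seq H), size s = size ctx ->
    thom t s = \sum_(w <- enum H | colour H w == c) \prod_(q <- L) root_value s q w.
Proof.
move=> LD szL; exists (Node c (canon (size ctx) (root_levels L)) (root_terms L)) => /=.
  rewrite canonK eqxx /=; apply/andP; split.
    by apply: leq_trans szL; rewrite size_pmap count_size.
  apply/allP => D; rewrite mem_pmap => /mapP[[l //|D'] /LD + [->]].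
  by rewrite mem_root_functions.
move=> H s sz; rewrite -[LHS]/(thom (Node _ _ _) s) thomE.
rewrite [LHS]big_mkcond [RHS]big_mkcond big_enum /=; apply: eq_bigr => w _.
rewrite /root_ok prod_root_value; case: eqP => //= _.
have -> : all (fun l => edge H w (nth w s l)) (canon (size ctx) (root_levels L)) =
          all (fun l => edge H w (nth w s l)) (root_levels L).
  apply: eq_all_r => l; rewrite mem_canon andbC; case: (boolP (l \in _)) => //=.
  rewrite mem_pmap => /mapP[[l' /LD + [->]|//]].
  by rewrite mem_root_functions.
by rewrite mulnbl.
Qed.

Lemma same_atoms_rcons (G G' : cgraph Gamma) (s : seq G) (s' : seq G') w w' :
  size s = size s' -> same_atoms s s' -> colour G w = colour G' w' ->
  (forall l, l < size s -> edge G w (nth w s l) = edge G' w' (nth w' s' l)) ->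
  same_atoms (rcons s w) (rcons s' w').
Proof.
move=> sz ss cc ee l x x'; rewrite size_rcons ltnS leq_eqVlt => /orP[/eqP->|ls].
  rewrite !nth_rcons -sz ltnn eqxx; split=> // m.
  rewrite ltnS leq_eqVlt => /orP[/eqP->|ms]; first by rewrite !nth_rcons -sz ltnn eqxx !edge_irr.
  rewrite !nth_rcons -sz ms (set_nth_default w) // ee //.
  by congr edge; apply: set_nth_default; rewrite -sz.
have [cl el] := ss l x x' ls; rewrite !nth_rcons -sz ls; split=> // m.
rewrite ltnS leq_eqVlt => /orP[/eqP->|ms]; last by rewrite !nth_rcons -sz ms el.
rewrite !nth_rcons -sz ltnn eqxx edge_sym [RHS]edge_sym.
rewrite (set_nth_default w) // ee //.
by congr edge; apply: set_nth_default; rewrite -sz.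
Qed.

Variables (G G' : cgraph Gamma) (n : nat).
Hypothesis n_large : #|G| + #|G'| <= n.

Definition agree (j : nat) (s : seq G) (s' : seq G') : Prop :=
  forall t, wf n j (size s) t -> thom t s = thom t s'.

(** Interpolation over the vertices outside the tuples. Sums over all vertices agree by [agree], and
    the contributions of the tuple entries agree separately and are subtracted. At most
    [#|G| + #|G'|] vectors occur, so branching [n] is enough. *)
Lemma perm_outer_values j (s : seq G) (s' : seq G') c :
  size s = size s' -> uniq s -> uniq s' -> same_atoms s s' -> agree j.+1 s s' ->
  perm_eq [seq [seq root_value s q w | q <- root_functions n j (size s)] |
            w <- [seq w <- [seq w <- enum G | w \notin s] | colour G w == c]]
          [seq [seq root_value s' q w | q <- root_functions n j (size s)] |
            w <- [seq w <- [seq w <- enum G' | w \notin s'] | colour G' w == c]].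
Proof.
move=> sz us us' ss ag.
apply: (@perm_eq_value_sums _ _ _ (root_functions n j (size s)) _ _ [::] _ _ n) => //.
- apply: leq_trans (size_undup _) _; apply: leq_trans n_large.
  rewrite size_cat !size_map !cardE; apply: leq_add; rewrite size_filter;
    by apply: leq_trans (count_size _ _) _; rewrite size_filter; apply: count_size.
- by move=> x _; rewrite big_nil.
- by move=> x _; rewrite big_nil.
move=> L LD szL; rewrite cat0s.
have [t wt tE] := thom_root_functions c LD szL.
have := ag t wt; rewrite !tE //.
rewrite (perm_big _ (perm_enum_cat us)) (perm_big _ (perm_enum_cat us')) !big_cat /=.
suff -> : \sum_(w <- s | colour G w == c) \prod_(q <- L) root_value s q w =
          \sum_(w <- s' | colour G' w == c) \prod_(q <- L) root_value s' q w.
  by move/addnI; rewrite !(big_filter _ (fun w => colour _ w == c)).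
pose h (H : cgraph Gamma) (r : seq H) w := (colour H w == c) * \prod_(q <- L) root_value r q w.
suff E : map (h G s) s = map (h G' s') s'.
  have sumE (H : cgraph Gamma) (r : seq H) :
    \sum_(w <- r | colour H w == c) \prod_(q <- L) root_value r q w = \sum_(x <- map (h H r) r) x.
    by rewrite big_map big_mkcond; apply: eq_bigr => w _; rewrite /h mulnbl.
  by rewrite !sumE E.
apply: map_eq_nth => // l x x' ls; have [cl el] := ss l x x' ls.
rewrite /h cl; congr (_ * _); rewrite !big_seq; apply: eq_bigr => q /LD.
rewrite mem_root_functions; case: q => [m ms|E wE] /=.
  rewrite (set_nth_default x) // el //; congr (nat_of_bool (edge _ _ _)).
  by apply: set_nth_default; rewrite -sz.
have ls' : l < size s' by rewrite -sz.
(* The new vertex repeats entry [l], so its level is identified with [l] and the count becomes one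
   over the original tuple. *)
rewrite -(@thom_rename_last _ n j _ s _ l) //; last by move=> _; split=> //; apply: set_nth_default.
have -> := ag (rename (size s) l (size s) E); last first.
  by apply: wf_leq (leqnn n) (leqnSn j) _; apply: wf_rename.
rewrite -(@thom_rename_last _ n j _ s' (nth x' s' l) l) -?sz //.
by move=> _; split=> //; apply: set_nth_default.
Qed.

(** The tuples list the distinct vertices chosen so far, and every variable points to an entry, or
    past the end if unassigned. A quantified vertex already listed leaves the tuples unchanged; the
    others are matched by value vector within their colour. *)
Lemma agree_sat (phi : cform Gamma) j (s : seq G) (s' : seq G')
    (a : assignment G) (a' : assignment G') :
  size s = size s' -> uniq s -> uniq s' -> same_atoms s s' -> agree j s s' ->
  (forall x, exists l, a x = onth s l /\ a' x = onth s' l) ->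
  qrank phi <= j -> sat a phi = sat a' phi.
Proof.
elim: phi j s s' a a' => [x y|x y|x c|psi IH|psi IH chi IH'|p x psi IH]
    j s s' a a' sz us us' ss ag aa' qr /=; have lookup := onth_pair sz.
- have [l [-> ->]] := aa' x; have [m [-> ->]] := aa' y.
  move: (lookup l) (lookup m).
  case: (onth s l) => [u|]; case: (onth s' l) => [u'|] //; case: (onth s m) => [v|]; case: (onth s' m) => [v'|] //.
  case=> ls -> -> [ms -> ->].
  by rewrite (set_nth_default u v) // (set_nth_default u' v') -?sz // !nth_uniq -?sz.
- have [l [-> ->]] := aa' x; have [m [-> ->]] := aa' y.
  move: (lookup l) (lookup m).
  case: (onth s l) => [u|]; case: (onth s' l) => [u'|] //; case: (onth s m) => [v|]; case: (onth s' m) => [v'|] //.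
  case=> ls -> -> [ms -> ->].
  rewrite (set_nth_default u v) // (set_nth_default u' v') -?sz //.
  by have [_ ->] := ss l u u' ls.
- have [l [-> ->]] := aa' x; move: (lookup l).
  case: (onth s l) => [u|]; case: (onth s' l) => [u'|] // [ls -> ->].
  by have [-> _] := ss l u u' ls.
- by congr (~~ _); apply: (IH j s s').
- move: qr; rewrite /= geq_max => /andP[q1 q2].
  by rewrite (IH j s s' a a') // (IH' j s s' a a').
case: j ag qr => // j ag; rewrite /= ltnS => qr.
congr (p <= _); rewrite !card_set_count.
rewrite (permP (perm_enum_cat us)) (permP (perm_enum_cat us')) !count_cat.
congr (_ + _).
  rewrite -(count_map _ id) -[RHS](count_map _ id); congr count.
  apply: map_eq_nth => // l u u' ls; apply: (IH j.+1 s s') => //; last exact: leqW.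
  move=> y; rewrite /update; case: eqP => // _; exists l.
  by rewrite (onth_lt u) // (onth_lt u') -?sz.
rewrite (count_by_colour (colour G)) [RHS](count_by_colour (colour G')).
apply: eq_bigr => c _.
rewrite -(count_map _ id) -[RHS](count_map _ id); apply/permP.
have := perm_outer_values c sz us us' ss ag; apply: perm_map_transfer.
move=> w w'; rewrite !mem_filter => /and3P[/eqP cw ws _] /and3P[/eqP cw' ws' _] /eq_in_map sig.
have sigE q : q \in root_functions n j (size s) -> root_value s q w = root_value s' q w'.
  exact: sig.
have sz' : size (rcons s w) = size (rcons s' w') by rewrite !size_rcons sz.
apply: (IH j (rcons s w) (rcons s' w')) => //.
- by rewrite rcons_uniq ws.
- by rewrite rcons_uniq ws'.
- apply: same_atoms_rcons => //; first by rewrite cw.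
  move=> l ls; have := sigE (inl l); rewrite mem_root_functions => /(_ ls) /=.
  by case: edge; case: edge.
- by move=> t; rewrite size_rcons => wt; have := sigE (inr t); rewrite mem_root_functions; apply.
move=> y; rewrite /update; case: eqP => _.
  by exists (size s); rewrite !onth_rcons -sz eqxx.
have [l [-> ->]] := aa' y; case: (ltngtP l (size s)) => ls.
- by exists l; rewrite !onth_rcons -sz ltn_eqF.
- by exists l; rewrite !onth_rcons -sz gtn_eqF.
(* An index equal to the old length meant unassigned but would now point at the new vertex, so it is
   shifted past the end. *)
exists l.+1; rewrite !onth_rcons -sz gtn_eqF ?ls // !onth_default -?sz ?ls //.
Qed.

End GameArgument.

(** * Connected terms *)

Section Reach.
Variables (Gamma : finType) (G : cgraph Gamma).

(** Since a step may stay in place, this is distance at most [r]. *)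
Fixpoint reach (r : nat) (u w : G) : bool :=
  if r is r'.+1 then [exists v, ((u == v) || edge G u v) && reach r' v w]
  else u == w.

Lemma reach_refl r u : reach r u u.
Proof. by elim: r => //= r IH; apply/existsP; exists u; rewrite eqxx. Qed.

Lemma reach_trans r s u v w : reach r u v -> reach s v w -> reach (r + s) u w.
Proof.
elim: r u => [|r IH] u /=; first by move/eqP->.
case/existsP=> x /andP[ux xv] vw; apply/existsP; exists x; rewrite ux.
exact: IH.
Qed.

Lemma reach_leq r s u v : r <= s -> reach r u v -> reach s u v.
Proof. by move=> rs uv; rewrite -(subnKC rs); apply: reach_trans (reach_refl _ _). Qed.

Lemma reach_edge u v : edge G u v -> reach 1 u v.
Proof. by move=> uv; apply/existsP; exists v; rewrite uv orbT /=. Qed.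

Lemma reach_sym r u v : reach r u v -> reach r v u.
Proof.
elim: r u => [|r IH] u /=; first by rewrite eq_sym.
case/existsP=> x /andP[ux /IH vx]; rewrite -/(reach r.+1 v u) -addn1.
apply: reach_trans vx _; case/orP: ux => [/eqP->|ux]; first exact: reach_refl.
by apply: reach_edge; rewrite edge_sym.
Qed.

Lemma card_reach d r u : (forall v, #|[set w | edge G v w]| <= d) ->
  #|[set w | reach r u w]| <= d.+1 ^ r.
Proof.
move=> deg; elim: r u => [|r IH] u.
  rewrite expn0 -(cards1 u); apply: subset_leq_card; apply/subsetP => w.
  by rewrite !inE eq_sym.
pose N := u |: [set w | edge G u w].
have sub : [set w | reach r.+1 u w] \subset \bigcup_(v in N) [set w | reach r v w].
  apply/subsetP=> w; rewrite inE => /existsP[v /andP[uv vw]].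
  by apply/bigcupP; exists v; rewrite !inE // eq_sym.
apply: leq_trans (subset_leq_card sub) _.
have leN : #|N| <= d.+1.
  by rewrite cardsU1 -add1n leq_add ?leq_b1.
apply: (@leq_trans (\sum_(v in N) d.+1 ^ r)); last by rewrite sum_nat_const expnS leq_mul2r leN orbT.
apply: (@leq_trans (\sum_(v in N) #|[set w | reach r v w]|)); last by apply: leq_sum.
by elim/big_rec2: _ => [|v m A _ le]; rewrite ?cards0 // (leq_trans (leq_card_setU _ _)) ?leq_add2l.
Qed.

End Reach.

Section Connected.
Variable Gamma : finType.
Implicit Types (t D : tm Gamma).

(** Every child subtree has an edge to its parent; by induction the term is a connected graph. *)
Fixpoint conn (i : nat) t : bool :=
  let: Node c A ch := t in all (fun D => touch i D && conn i.+1 D) ch.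

Lemma thom_gt0 (G : cgraph Gamma) c A ch (ctx : seq G) :
  reflect (exists w, root_ok c A ctx w && (0 < \prod_(D <- ch) thom D (rcons ctx w)))
          (0 < thom (Node c A ch) ctx).
Proof.
rewrite thomE lt0n sum_nat_eq0 negb_forall; apply: (iffP existsP) => -[w];
  by rewrite ?negb_imply ?lt0n => h; exists w; rewrite ?negb_imply ?lt0n.
Qed.

Lemma prod_gt0_in (I : eqType) (s : seq I) (F : I -> nat) :
  (0 < \prod_(i <- s) F i) = all (fun i => 0 < F i) s.
Proof. by elim: s => [|x s IH]; rewrite ?big_nil // big_cons muln_gt0 IH. Qed.

(** If the edge to level [l] comes from a child subtree, connectivity gives that subtree an edge to
    the root as well. By induction the image of its own root is near both ends, so the radius
    doubles with each level. *)
Lemma touch_near n j c A ch (G : cgraph Gamma) (ctx : seq G) w l :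
  wf n j.+1 (size ctx) (Node c A ch) -> conn (size ctx) (Node c A ch) ->
  root_ok c A ctx w -> 0 < \prod_(D <- ch) thom D (rcons ctx w) ->
  l < size ctx -> touch l (Node c A ch) -> reach (2 ^ j) w (nth w ctx l).
Proof.
elim: j c A ch ctx w l => [|j IH] c A ch ctx w l /and3P[_ _ /allP wch] /allP cch
    /andP[_ /allP okA] pos ls /orP[lA|/hasP[D Dch lD]].
- by apply: reach_edge; apply: okA.
- by have := wch _ Dch.
- apply: (@reach_leq _ _ 1); first by rewrite expn_gt0.
  by apply: reach_edge; apply: okA.
case/andP: (cch _ Dch) => iD cD; have wD := wch _ Dch.
rewrite prod_gt0_in in pos; have := allP pos _ Dch.
case: D wD cD iD lD {Dch} => c' A' ch' wD cD iD lD /thom_gt0[u /andP[oku posu]].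
rewrite -(size_rcons ctx w) in wD cD.
have near l' : l' <= size ctx -> touch l' (Node c' A' ch') ->
    reach (2 ^ j) u (nth u (rcons ctx w) l').
  by move=> ls'; apply: IH wD cD oku posu _; rewrite size_rcons.
have := near _ (leqnn _) iD; have := near _ (ltnW ls) lD.
rewrite !nth_rcons ls ltnn eqxx => ul uw.
rewrite expnS mul2n -addnn (set_nth_default u) //.
exact: reach_trans (reach_sym uw) ul.
Qed.

(* Only the branches leading to the levels [l] and [l'] are kept. *)
Lemma prune n j i t l l' : wf n j i t -> conn i t -> touch l t -> touch l' t ->
  exists t', [/\ wf 2 j i t', conn i t', touch l t', touch l' t' &
    forall (G : cgraph Gamma) (ctx : seq G), 0 < thom t ctx -> 0 < thom t' ctx].
Proof.
elim: j i t l l' => // j IH i [c A ch] l l' /and3P[EA _ /allP wch] /allP cch tl tl'.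
have branch m : touch m (Node c A ch) -> exists s : seq (tm Gamma),
    [/\ size s <= 1, all (wf 2 j i.+1) s, all (fun D => touch i D && conn i.+1 D) s,
        (m \in A) || has (touch m) s &
        forall (G : cgraph Gamma) (ctx : seq G), 0 < \prod_(D <- ch) thom D ctx ->
          0 < \prod_(D <- s) thom D ctx].
  case/orP=> [mA|/hasP[D Dch mD]].
    by exists [::]; split=> //; [rewrite mA | move=> G ctx _; rewrite big_nil].
  (* The kept branch must still touch its parent at level [i] besides [m]; this is why two levels
     are tracked. *)
  case/andP: (cch _ Dch) => iD cD; have [D' [w' c' m' i' p']] := IH _ _ m i (wch _ Dch) cD mD iD.
  exists [:: D']; split; rewrite /= ?w' ?i' ?c' ?m' ?orbT // => G ctx.
  by rewrite prod_gt0_in big_seq1 => /allP/(_ _ Dch); apply: p'.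
have [s [s1 ws cs ts ps]] := branch l tl; have [s' [s1' ws' cs' ts' ps']] := branch l' tl'.
exists (Node c A (s ++ s')); split.
- by rewrite /= EA size_cat (leq_add s1 s1') all_cat ws ws'.
- by rewrite /= all_cat cs cs'.
- by rewrite /= has_cat orbA ts.
- by rewrite /= has_cat orbCA ts' orbT.
move=> G ctx /thom_gt0[w /andP[ok pos]]; apply/thom_gt0; exists w; rewrite ok /=.
by rewrite big_cat muln_gt0 ps ?ps'.
Qed.

Lemma conn_rename n j i b m t : i <= m -> wf n j m.+1 t -> conn m.+1 t ->
  conn m (rename i b m t).
Proof.
elim: j m t => // j IH m [c A ch] im /and3P[_ _ /allP wch] /= /allP cch.
rewrite all_map; apply/allP => D Dch /=; have /andP[tD cD] := cch _ Dch.
rewrite (IH _ _ (leqW im) (wch _ Dch) cD) andbT.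
have := @touch_rename _ n j i b m.+1 D m.+1 (leqW im) (wch _ Dch) (leqnn _).
rewrite /drop_level gtn_eqF ?ltnS // => /(_ isT tD).
by rewrite ltnNge leqW.
Qed.

(** A factor below the root that does not touch the root is independent of the root's image and can
    be taken out of the sum. The branching may grow in the process, hence [n']. *)
Lemma conn_decomposition n j i t : wf n j i t -> exists n' s,
  [/\ all (wf n' j i) s, all (conn i) s &
      forall (G : cgraph Gamma) (ctx : seq G), size ctx = i ->
        thom t ctx = \prod_(D <- s) thom D ctx].
Proof.
elim: j i t => // j IH i [c A ch] /and3P[EA _ wch].
have [n1 [S [wS cS SE]]] : exists n' S, [/\ all (wf n' j i.+1) S, all (conn i.+1) S &
    forall (G : cgraph Gamma) (ctx : seq G), size ctx = i.+1 ->
      \prod_(D <- ch) thom D ctx = \prod_(D <- S) thom D ctx].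
  elim: ch wch => [_|D ch IHch /= /andP[/IH[n1 [s [ws cs sE]]] /IHch[n2 [S [wS cS SE]]]]].
    by exists 0, [::].
  exists (maxn n1 n2), (s ++ S); split.
  - rewrite all_cat; apply/andP; split; apply/allP=> E; [move/(allP ws)|move/(allP wS)];
      apply: wf_leq => //; [exact: leq_maxl|exact: leq_maxr].
  - by rewrite all_cat cs.
  by move=> G ctx sz; rewrite big_cons big_cat /= -sE // -SE.
pose St := [seq D <- S | touch i D]; pose Sr := [seq D <- S | ~~ touch i D].
(* The target 0 of the renaming is arbitrary: the terms in [Sr] do not touch level [i]. *)
exists (maxn n1 (size S)), (Node c A St :: map (rename i 0 i) Sr); split.
- apply/andP; split.
    rewrite /= EA size_filter (leq_trans (count_size _ _)) ?leq_maxr //=.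
    by apply/allP => D; rewrite mem_filter => /andP[_ /(allP wS)]; apply: wf_leq => //; apply: leq_maxl.
  apply/allP => _ /mapP[D + ->]; rewrite mem_filter => /andP[_ /(allP wS)/wf_rename wD].
  by apply: wf_leq (wD _ _); [exact: leq_maxl | exact: leqnSn].
- apply/andP; split.
    by apply/allP => D; rewrite mem_filter => /andP[-> /(allP cS)].
  apply/allP => _ /mapP[D + ->]; rewrite mem_filter => /andP[_ DS].
  by apply: conn_rename (allP wS _ DS) (allP cS _ DS).
move=> G ctx sz; rewrite big_cons big_map !thomE big_distrl /=; apply: eq_bigr => w _.
rewrite SE ?size_rcons ?sz // (bigID (touch i)) /= !big_filter; congr (_ * _).
rewrite [LHS]big_seq_cond [RHS]big_seq_cond; apply: eq_bigr => D /andP[/(allP wS) wD ntD]; rewrite -sz in wD ntD *.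
by rewrite (thom_rename_last (v := w) wD) // (negPf ntD).
Qed.

End Connected.

(** * Bounded degree *)

Fixpoint thom_bound (n N j : nat) : nat :=
  if j is j'.+1 then N * thom_bound n N j' ^ n else 1.

Lemma thom_bound_gt0 n N j : 0 < N -> 0 < thom_bound n N j.
Proof. by move=> N0; elim: j => //= j IH; rewrite muln_gt0 N0 expn_gt0 IH. Qed.

Section BoundedBranching.
Variables (Gamma : finType) (d k : nat).
Implicit Types (t D : tm Gamma).

Definition ball_bound : nat := d.+1 ^ (2 ^ k).
(** [2 * ball_bound] counts the value vectors from both graphs. The extra 2 leaves room for the
    child used as weight, and makes pruned terms, of branching at most two, well formed. *)
Definition branch_bound : nat := 2 * ball_bound + 2.
(** The power bounds the number of value vectors at the root; the first summand admits children of
    branching [branch_bound]. *)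
Definition top_bound (g : nat) : nat :=
  branch_bound +
  (thom_bound branch_bound ball_bound k).+2 ^ terms_bound g branch_bound k k.

Section OneGraph.
Variable G : cgraph Gamma.
Hypothesis degG : max_degree G <= d.

Lemma card_ball r (u : G) : r <= 2 ^ k -> #|[set w | reach r u w]| <= ball_bound.
Proof.
have deg (v : G) : #|[set w | edge G v w]| <= d.
  by apply: leq_trans degG; apply: (leq_bigmax v).
by move=> rk; apply: leq_trans (card_reach r u deg) _; rewrite leq_pexp2l.
Qed.

Definition witnesses c (A : seq nat) (L0 : seq (tm Gamma)) (ctx : seq G) : seq G :=
  [seq w <- enum G | root_ok c A ctx w && (0 < \prod_(D <- L0) thom D (rcons ctx w))].

Lemma thom_witnesses c A L0 ch (ctx : seq G) :
  (forall w, 0 < \prod_(D <- ch) thom D (rcons ctx w) ->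
             0 < \prod_(D <- L0) thom D (rcons ctx w)) ->
  thom (Node c A ch) ctx =
  \sum_(w <- witnesses c A L0 ctx) \prod_(D <- ch) thom D (rcons ctx w).
Proof.
move=> chL0; rewrite thomE big_filter [LHS]big_mkcond [RHS]big_mkcond big_enum /=.
apply: eq_bigr => w _; case: ifP => //= _; case: ifP => //.
by have := chL0 w; case: posnP => // p /(_ isT) ->.
Qed.

(** The term made of the root and [L0] is connected and touches level [l], so all witnesses lie in
    one ball around the vertex there. *)
Lemma size_witnesses n j c A L0 (ctx : seq G) l : j <= k ->
  wf n j.+1 (size ctx) (Node c A L0) -> conn (size ctx) (Node c A L0) ->
  l < size ctx -> touch l (Node c A L0) ->
  size (witnesses c A L0 ctx) <= ball_bound.
Proof.
move=> jk wL cL ls tL; case Ec: ctx ls => [//|u s'] ls; rewrite -{s'}Ec in ls *.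
apply: leq_trans (@card_ball (2 ^ j) (nth u ctx l) _); last by rewrite leq_exp2l.
rewrite cardE; apply: uniq_leq_size; first by rewrite filter_uniq ?enum_uniq.
move=> w; rewrite mem_filter mem_enum inE => /andP[/andP[ok pos] _].
by apply: reach_sym; rewrite (set_nth_default w) //; apply: touch_near wL cL ok pos ls tL.
Qed.

(** The root has at most [ball_bound] contributing images, and each child touches the root, so
    induction bounds every factor. *)
Lemma thom_le n j i t l (ctx : seq G) : j <= k -> wf n j i t -> conn i t ->
  l < i -> touch l t -> size ctx = i -> thom t ctx <= thom_bound n ball_bound j.
Proof.
have N0 : 0 < ball_bound by rewrite expn_gt0.
elim: j i t l ctx => // j IH i [c A ch] l ctx jk wt ct li lt sz; rewrite -sz in wt ct li.
rewrite (@thom_witnesses c A ch ch) //.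
case/and3P: (wt) => _ szch /allP wch; have /allP cch := ct.
apply: (@leq_trans (\sum_(w <- witnesses c A ch ctx) thom_bound n ball_bound j ^ n)).
  apply: leq_sum => w _; apply: (@leq_trans (thom_bound n ball_bound j ^ size ch)); last first.
    by rewrite leq_pexp2l // thom_bound_gt0.
  elim: ch szch wch cch {wt ct lt} => [|D ch IHch] szch wch cch; first by rewrite big_nil.
  rewrite big_cons expnS leq_mul //.
    have /andP[iD cD] := cch D (mem_head _ _).
    apply: IH (wch D (mem_head _ _)) cD (leqnn _) iD _; first exact: ltnW.
    by rewrite size_rcons.
  apply: IHch => [|E Ech|E Ech]; first exact: ltnW.
    by apply: wch; rewrite inE Ech orbT.
  by apply: cch; rewrite inE Ech orbT.
rewrite big_const_seq count_predT iter_addn_0 mulnC leq_mul2r.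
by rewrite (@size_witnesses n j _ _ _ _ l) ?orbT // ltnW.
Qed.

End OneGraph.

(** The terms that may hang below a root at level [i] within a connected term. *)
Definition conn_terms (n j i : nat) : seq (tm Gamma) :=
  [seq D <- terms Gamma n j i.+1 | conn i.+1 D && touch i D].

Lemma mem_conn_terms n j i D :
  (D \in conn_terms n j i) = [&& conn i.+1 D, touch i D & wf n j i.+1 D].
Proof. by rewrite mem_filter mem_terms andbA. Qed.

Variables G G' : cgraph Gamma.
Hypotheses (degG : max_degree G <= d) (degG' : max_degree G' <= d).

Definition agree_conn (n j i : nat) (s : seq G) (s' : seq G') : Prop :=
  forall t, wf n j i.+1 t -> conn i.+1 t -> touch i t -> thom t s = thom t s'.

(** Positivity of [L0] follows from that of [ch], so restricting to witnesses loses nothing.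
    Interpolation matches witnesses with equal values on bounded terms, and [lift] extends the
    agreement of matched witnesses to all children in [ch]. *)
Lemma transfer_witnesses j c A (L0 ch : seq (tm Gamma)) (s : seq G) (s' : seq G') M :
  size s = size s' ->
  (forall w w', agree_conn branch_bound j (size s) (rcons s w) (rcons s' w') ->
     forall n, agree_conn n j (size s) (rcons s w) (rcons s' w')) ->
  let D := conn_terms branch_bound j (size s) in
  {subset L0 <= D} ->
  size (undup ([seq [seq thom E (rcons s w) | E <- D] | w <- witnesses c A L0 s] ++
               [seq [seq thom E (rcons s' w) | E <- D] | w <- witnesses c A L0 s'])) <= M ->
  (forall L, {subset L <= D} -> size L <= M ->
     thom (Node c A (L0 ++ L)) s = thom (Node c A (L0 ++ L)) s') ->
  (forall (H : cgraph Gamma) (r : seq H), 0 < \prod_(E <- ch) thom E r ->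
     0 < \prod_(E <- L0) thom E r) ->
  forall n, all (wf n j (size s).+1) ch -> conn (size s) (Node c A ch) ->
  thom (Node c A ch) s = thom (Node c A ch) s'.
Proof.
move=> sz lift D L0D szM eqL chL0 n /allP wch /allP cch.
have catL0 (H : cgraph Gamma) (r : seq H) L w :
    0 < \prod_(E <- L0 ++ L) thom E (rcons r w) -> 0 < \prod_(E <- L0) thom E (rcons r w).
  by rewrite big_cat muln_gt0 => /andP[].
rewrite !(@thom_witnesses _ c A L0) //; try by move=> w; apply: chL0.
have pW : perm_eq [seq [seq thom E (rcons s w) | E <- D] | w <- witnesses c A L0 s]
                  [seq [seq thom E (rcons s' w) | E <- D] | w <- witnesses c A L0 s'].
  apply: (@perm_eq_value_sums _ _ _ D (fun E w => thom E (rcons s w))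
            (fun E w => thom E (rcons s' w)) L0 _ _ M) => //.
  - by move=> w; rewrite mem_filter => /andP[/andP[]].
  - by move=> w; rewrite mem_filter => /andP[/andP[]].
  move=> L LD szL; rewrite -!thom_witnesses; first exact: eqL.
    by move=> w; apply: catL0.
  by move=> w; apply: catL0.
suff pT : perm_eq [seq \prod_(E <- ch) thom E (rcons s w) | w <- witnesses c A L0 s]
                  [seq \prod_(E <- ch) thom E (rcons s' w) | w <- witnesses c A L0 s'].
  by have := perm_big _ pT (op := addn) (x := 0) (P := xpredT) (F := id); rewrite !big_map.
apply: perm_map_transfer pW => w w' _ _ /eq_in_map sig.
rewrite !big_seq; apply: eq_bigr => E Ech; have /andP[tE cE] := cch _ Ech.
apply: (lift w w' _ n) => // [t wt ct tt|]; last exact: wch.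
by apply: sig; rewrite mem_conn_terms ct tt.
Qed.

(** Induction on the height. The witnesses fill at most one ball in each graph, so at most
    [2 * ball_bound] value vectors occur and interpolation needs no more children than that, besides
    the weight. *)
Lemma agree_conn_lift j i (s : seq G) (s' : seq G') n : j <= k ->
  size s = i.+1 -> size s' = i.+1 ->
  agree_conn branch_bound j i s s' -> agree_conn n j i s s'.
Proof.
elim: j i s s' n => // j IH i s s' n jk sz sz' ag [c A ch] wt ct it.
have [EA _ wch] := and3P wt.
have [L0 [szL0 L0D chL0 tL0]] : exists L0 : seq (tm Gamma),
    [/\ size L0 <= 1, {subset L0 <= conn_terms branch_bound j (size s)},
        forall (H : cgraph Gamma) (r : seq H), 0 < \prod_(E <- ch) thom E r ->
          0 < \prod_(E <- L0) thom E r
      & forall L, touch i (Node c A (L0 ++ L))].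
  case/orP: it => [iA|/hasP[D Dch iD]].
    by exists [::]; split=> // [H r _|L]; rewrite ?big_nil //= iA.
  have /andP[tD cD] := allP ct _ Dch.
  have [D' [w' c' t' i' p']] := prune (allP wch _ Dch) cD tD iD.
  exists [:: D']; split=> // [E|H r|L].
  - rewrite inE => /eqP->; rewrite mem_conn_terms sz c' t' /=.
    by apply: wf_leq w' => //; rewrite leq_addl.
  - by rewrite prod_gt0_in big_seq1 => /allP/(_ _ Dch); apply: p'.
  by rewrite /= i' orbT.
have wfL L : {subset L <= conn_terms branch_bound j (size s)} ->
    size L <= 2 * ball_bound ->
    wf branch_bound j.+1 i.+1 (Node c A (L0 ++ L)) /\ conn i.+1 (Node c A (L0 ++ L)).
  move=> LD szL; have DE E : E \in L0 ++ L -> [&& conn i.+2 E, touch i.+1 E & wf branch_bound j i.+2 E].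
    by rewrite mem_cat => /orP[/L0D|/LD]; rewrite mem_conn_terms sz.
  split; last by apply/allP => E /DE/and3P[cE tE _]; apply/andP.
  rewrite /= EA size_cat /=; apply/andP; split.
    by rewrite addnC; apply: leq_add => //; apply: leq_trans szL0 _.
  by apply/allP => E /DE/and3P[].
have [wL0 cL0] := wfL [::] (fun _ h => False_ind _ (notF h)) (leq0n _).
rewrite cats0 in wL0 cL0; have iL0 := tL0 [::]; rewrite cats0 in iL0.
apply: (@transfer_witnesses j c A L0 ch s s' (2 * ball_bound)) => //.
- by rewrite sz.
- move=> w w' ag' n'; apply: IH => //; [exact: ltnW | |];
    by rewrite size_rcons ?sz ?sz'.
- apply: leq_trans (size_undup _) _; rewrite size_cat !size_map mul2n -addnn.
  apply: leq_add.
    apply: (@size_witnesses _ degG branch_bound j _ _ _ _ i); rewrite ?sz //; exact: ltnW.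
  apply: (@size_witnesses _ degG' branch_bound j _ _ _ _ i); rewrite ?sz' //; exact: ltnW.
- by move=> L LD szL; have [wL cL] := wfL L LD szL; apply: ag.
- by rewrite sz; apply: wch.
- by rewrite sz.
Qed.

(** No earlier vertex confines the images of the root, so their number is unbounded. But the vectors
    have boundedly many coordinates, each of bounded value, so few distinct vectors occur. *)
Lemma top_conn_lift n t : 0 < k ->
  (forall u, wf (top_bound #|Gamma|) k 0 u -> conn 0 u ->
     thom u ([::] : seq G) = thom u ([::] : seq G')) ->
  wf n k 0 t -> conn 0 t -> thom t ([::] : seq G) = thom t ([::] : seq G').
Proof.
case Ek: k => [//|k'] _; rewrite -[in wf _ _ _ t]Ek.
have kk' : k' <= k by rewrite Ek.
case: t => c A ch eqT; rewrite Ek => wt ct; have [EA _ wch] := and3P wt.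
set M := (thom_bound branch_bound ball_bound k).+2 ^ terms_bound #|Gamma| branch_bound k k.
apply: (@transfer_witnesses k' c A [::] ch [::] [::] M) => //.
- by move=> w w' ag' n'; apply: agree_conn_lift.
(* There are [V.+1] possible values; the second successor in [V.+2] comes from counting all lists up
   to the given length. *)
- pose V := thom_bound branch_bound ball_bound k'; pose I := iota 0 V.+1.
  apply: (@leq_trans (size (seqs_le (size (conn_terms branch_bound k' 0)) I))).
    apply: uniq_leq_size; first exact: undup_uniq.
    move=> x; rewrite mem_undup mem_cat mem_seqs_le.
    by case/orP=> /mapP[w _ ->]; rewrite size_map leqnn; apply/allP => _ /mapP[E + ->];
      rewrite mem_conn_terms => /and3P[cE tE wE]; rewrite /= /I mem_iota add0n ltnS /=;
      [apply: (thom_le degG kk' wE cE _ tE) | apply: (thom_le degG' kk' wE cE _ tE)].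
  apply: leq_trans (size_seqs_le _ _) _; rewrite /I size_iota.
  have n0 : 0 < branch_bound by rewrite /branch_bound addnS.
  have VV : V <= thom_bound branch_bound ball_bound k.
    rewrite Ek /= -/V; apply: (@leq_trans (V ^ branch_bound)).
      by rewrite -{1}(expn1 V) leq_pexp2l // thom_bound_gt0 // expn_gt0.
    by rewrite leq_pmull // expn_gt0.
  apply: (@leq_trans (V.+2 ^ terms_bound #|Gamma| branch_bound k k)).
    rewrite leq_exp2l //; apply: leq_trans (_ : _ <= size (terms Gamma branch_bound k' 1)) _.
      by rewrite size_filter count_size.
    apply: leq_trans (@size_terms Gamma branch_bound k' 1 k _) _; first by rewrite add1n ltnS.
    rewrite [in X in _ <= X]Ek /= -Ek.
    set e := terms_bound _ _ _ _; case: (posnP #|Gamma|) => [/card0_eq /(_ c)|g0] //.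
    apply: (@leq_trans (e.+1 ^ branch_bound)); last by rewrite leq_pmull // muln_gt0 g0 expn_gt0.
    apply: (@leq_trans (e.+1 ^ 1)); first by rewrite expn1.
    by rewrite leq_pexp2l.
  by rewrite /M; case: (terms_bound _ _ _ _) => // e; rewrite leq_exp2r.
- move=> L LD szL; apply: eqT.
    rewrite /= EA /=; apply/andP; split; first by apply: leq_trans szL (leq_addl _ _).
    apply/allP=> E /LD; rewrite mem_conn_terms => /and3P[_ _].
    by apply: wf_leq => //; apply: leq_addr.
  by apply/allP=> E /LD; rewrite mem_conn_terms => /and3P[cE tE _]; apply/andP.
- by move=> H r _; rewrite big_nil.
- exact: wch.
Qed.

(** The game uses terms of branching [#|G| + #|G'|], not bounded in [k] and [d]. Decomposition into
    connected terms reduces their counts to those of bounded branching. *)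
Lemma bounded_terms_C_equiv : 0 < k ->
  (forall t, wf (top_bound #|Gamma|) k 0 t ->
     thom t ([::] : seq G) = thom t ([::] : seq G')) ->
  C_equiv k G G'.
Proof.
move=> k0 eqT phi _ qr.
apply: (@agree_sat _ _ _ (#|G| + #|G'|) (leqnn _) phi k [::] [::]) => //; last first.
  by move=> x; exists 0.
move=> t /conn_decomposition[n [s [/allP ws /allP cs tE]]].
rewrite !tE // !big_seq; apply: eq_bigr => u us.
apply: (@top_conn_lift n) => // [v wv _||]; [exact: eqT|exact: ws|exact: cs].
Qed.

End BoundedBranching.

(** * The family of graphs *)

(* The nodes of the complete [b]-ary tree of height [k] are numbered by reading
   the path [a_0, a_1, ...] from the root to the node as the bijective base-[b]
   numeral [\sum_i (a_i + 1) * b ^ i]; then [u] is an ancestor of [v] iff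
   [u <= v] and [b ^ level u] divides [v - u]. *)
Fixpoint nodes (b k : nat) : nat := if k is k'.+1 then (b * nodes b k').+1 else 0.

Definition level (b k u : nat) : nat := \sum_(l < k) (nodes b l.+1 <= u).

Definition anc (b k u v : nat) : bool := (u <= v) && (b ^ level b k u %| v - u).

Definition digit (beta c p : nat) : nat := c %/ beta ^ p %% beta.

Lemma digits_exist beta P (f : nat -> nat) : (forall p, p < P -> f p < beta) ->
  exists2 c, c < beta ^ P & forall p, p < P -> digit beta c p = f p.
Proof.
elim: P f => [|P IH] f fb; first by exists 0.
have b0 : 0 < beta by apply: leq_ltn_trans (fb 0 _).
have [c cP cE] := IH (f \o succn) (fun p pP => fb p.+1 pP).
exists (f 0 + c * beta).
  rewrite expnS; apply: (@leq_trans (beta + c * beta)).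
    by rewrite ltn_add2r fb.
  by rewrite -mulSn mulnC leq_mul2l cP orbT.
move=> [_|p pP]; first by rewrite /digit expn0 divn1 addnC modnMDl modn_small ?fb.
rewrite -[RHS](cE p pP) /digit expnS divnMA; congr (_ %/ _ %% _).
by rewrite addnC divnMDl // divn_small ?addn0 ?fb.
Qed.

(** An antitone predicate holds on an initial segment, so counting its values locates the end of the
    segment. *)
Lemma ltn_sum_antitone (P : pred nat) k l : (forall m, P m.+1 -> P m) ->
  (l < \sum_(i < k) P i) = (l < k) && P l.
Proof.
move=> anti; elim: k P anti l => [|k IH] P anti l; first by rewrite big_ord0.
rewrite big_ord_recl /=; under eq_bigr do rewrite /bump /= add1n.
have {}IH := IH (P \o succn) (fun m => anti m.+1).
case P0: (P 0); first by case: l => [|l]; rewrite /= ?P0 // add1n ltnS IH.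
have PF m : P m = false by elim: m => // m Pm; apply: contraFF (anti m) Pm.
by rewrite add0n IH /= !PF !andbF.
Qed.

Section Numbering.
Variables b k : nat.
Hypothesis b0 : 0 < b.

Lemma nodesS l : nodes b l.+1 = nodes b l + b ^ l.
Proof.
elim: l => [|l IH]; first by rewrite /= muln0.
by rewrite [LHS]/= -/(nodes b l.+1) {1}IH mulnDr -expnS -addSn.
Qed.

Lemma leq_nodes l m : l <= m -> nodes b l <= nodes b m.
Proof.
move=> lm; rewrite -(subnKC lm); elim: (m - l) => [|i IH]; first by rewrite addn0.
by rewrite addnS nodesS (leq_trans IH) // leq_addr.
Qed.

Lemma ltn_level u l : (l < level b k u) = (l < k) && (nodes b l.+1 <= u).
Proof.
apply: (ltn_sum_antitone _ _ (P := fun l => nodes b l.+1 <= u)) => m.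
by apply: leq_trans; apply: leq_nodes.
Qed.

Lemma leq_level u v : u <= v -> level b k u <= level b k v.
Proof.
move=> uv; apply: leq_sum => l _; case: (leqP _ u) => // lu.
by rewrite (leq_trans lu uv).
Qed.

Lemma level_lt u : u < nodes b k -> level b k u < k.
Proof.
case Ek: {1 3}k => [|k'] // uk; rewrite ltnNge ltn_level Ek ltnSn /=.
by rewrite -ltnNge.
Qed.

Lemma level_range u : u < nodes b k ->
  nodes b (level b k u) <= u < nodes b (level b k u) + b ^ level b k u.
Proof.
move=> uk; apply/andP; split.
  case E: (level b k u) => [//|l].
  by have := ltn_level u l; rewrite E ltnSn => /esym/andP[].
have := ltn_level u (level b k u); rewrite ltnn level_lt // andTb => /esym/negbT.
by rewrite -ltnNge nodesS.
Qed.

Lemma anc_refl u : anc b k u u.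
Proof. by rewrite /anc leqnn subnn dvdn0. Qed.

Lemma anc_trans u v w : anc b k u v -> anc b k v w -> anc b k u w.
Proof.
move=> /andP[uv duv] /andP[vw dvw]; rewrite /anc (leq_trans uv vw) /=.
rewrite -(subnK vw) -addnBA // dvdn_add //.
by apply: dvdn_trans dvw; rewrite dvdn_exp2l ?leq_level.
Qed.

Lemma anc_comparable u v w : anc b k u w -> anc b k v w ->
  anc b k u v || anc b k v u.
Proof.
wlog uv : u v / u <= v => [H|].
  by case: (leqP u v) => [/H//|/ltnW/H h] uw vw; rewrite orbC h.
move=> /andP[uw duw] /andP[vw dvw]; rewrite /anc uv /=.
suff -> : b ^ level b k u %| v - u by [].
have dv : b ^ level b k u %| w - v.
  by apply: dvdn_trans dvw; rewrite dvdn_exp2l ?leq_level.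
by rewrite -(dvdn_addr _ dv) addnBA // subnK.
Qed.

(** The numbers of one level [l] form an interval of length [b ^ l], too short for a positive
    multiple of [b ^ l] as a difference. *)
Lemma anc_level_eq u v : u < nodes b k -> v < nodes b k -> anc b k u v ->
  level b k u = level b k v -> u = v.
Proof.
move=> uk vk /andP[uv duv] lev; apply/eqP; rewrite eqn_leq uv -subn_eq0.
have /andP[lu _] := level_range uk; have /andP[_ gv] := level_range vk.
rewrite -lev in gv; apply: contraLR duv; rewrite -lt0n => pos; apply/negP => /(dvdn_leq pos).
rewrite leqNgt => /negP; apply; rewrite ltn_subLR //.
by apply: leq_trans gv _; rewrite leq_add2r.
Qed.

End Numbering.

Section Family.
Variables (Gamma : finType) (b k : nat).
Hypotheses (g0 : 0 < #|Gamma|) (b0 : 0 < b).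

(** In base [#|Gamma|.+1], the first [nodes b k] digits of [c] give the colours and the following
    ones the edge matrix row by row. The base is at least 2 even with a single colour. Colours are
    reduced modulo [#|Gamma|], so every number codes a graph. *)
Definition edge_bit (c u v : nat) : bool :=
  0 < digit #|Gamma|.+1 c (nodes b k + (u * nodes b k + v)).

Definition tree_edge (c : nat) : rel nat := fun u v =>
  (u != v) && ((anc b k u v && edge_bit c u v) || (anc b k v u && edge_bit c v u)).

Definition tree_colour (c u : nat) : Gamma :=
  enum_val (Ordinal (ltn_pmod (digit #|Gamma|.+1 c u) g0)).

Definition tree_graph (c : nat) : cgraph Gamma.
Proof.
refine (@CGraph Gamma 'I_(nodes b k) (fun u v => tree_edge c u v) (fun u => tree_colour c u) _ _).
- by move=> u v; rewrite /tree_edge eq_sym orbC.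
- by move=> u; rewrite /tree_edge eqxx.
Defined.

Lemma tree_depth_tree_graph c : tree_depth (tree_graph c) <= k.
Proof.
pose R : {set tree_graph c * tree_graph c} := 
  [set p : tree_graph c * tree_graph c | anc b k (p.1 : 'I__) (p.2 : 'I__)].
have RE (u v : 'I_(nodes b k)) : rel_of R u v = anc b k u v by rewrite /rel_of inE.
rewrite /tree_depth; case: ex_minnP => m _ /(_ (height (rel_of R))) min.
apply: leq_trans (min _) _.
  apply/existsP; exists R; rewrite eqxx andbT; apply/andP; split; last first.
    apply/forallP => u; apply/forallP => v; apply/implyP => /andP[_].
    by rewrite !RE => /orP[/andP[->]|/andP[->]]; rewrite ?orbT.
  apply/andP; split; last first.
    apply/forallP => t; apply/forall_inP => u ut; apply/forall_inP => v vt.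
    by move: ut vt; rewrite !inE !RE; apply: anc_comparable.
  apply/and3P; split.
  - by apply/forallP => u; rewrite RE anc_refl.
  - apply/forallP => u; apply/forallP => v; apply/implyP; rewrite !RE.
    by case/andP=> /andP[uv _] /andP[vu _]; apply/eqP/val_inj/anti_leq; rewrite uv.
  - apply/forallP => u; apply/forallP => v; apply/forallP => w; apply/implyP.
    by rewrite !RE => /andP[]; apply: anc_trans.
apply/bigmax_leqP => C chainC.
(* Distinct elements of a chain lie on distinct levels, of which there are [k]. *)
pose lv (u : 'I_(nodes b k)) : 'I_k := Ordinal (level_lt (ltn_ord u)).
have inj : {in C &, injective lv}.
  move=> u v uC vC /(congr1 val) /= lev; apply: val_inj.
  have /orP := forall_inP (forall_inP chainC _ uC) _ vC; rewrite !RE.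
  case=> a; first exact: anc_level_eq a lev.
  by apply/esym; apply: anc_level_eq a (esym lev).
by rewrite -(card_in_imset inj) -[X in _ <= X](card_ord k) max_card.
Qed.

End Family.

(** * The complete tree by recursion, and its numbering *)

Section CompleteTree.
Variable b : nat.

(** [None] is the root and [Some (a, y)] the node [y] of the [a]-th subtree. This form follows the
    recursion of terms; [num] translates it into the arithmetic numbering. *)
Fixpoint ctree (j : nat) : finType :=
  if j is j'.+1 then option ('I_b * ctree j')%type else void.

Fixpoint num (j : nat) : ctree j -> nat :=
  match j with
  | 0 => fun _ => 0
  | j'.+1 => fun x : option ('I_b * ctree j') =>
      if x is Some (a, y) then (a + b * num y).+1 else 0
  end.

Fixpoint tlevel (j : nat) : ctree j -> nat :=
  match j with
  | 0 => fun _ => 0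
  | j'.+1 => fun x : option ('I_b * ctree j') =>
      if x is Some (a, y) then (tlevel y).+1 else 0
  end.

Fixpoint tanc (j : nat) : ctree j -> ctree j -> bool :=
  match j with
  | 0 => fun _ _ => true
  | j'.+1 => fun x y : option ('I_b * ctree j') =>
      match x, y with
      | None, _ => true
      | Some (a, x'), Some (a', y') => (a == a') && tanc x' y'
      | Some _, None => false
      end
  end.

(** The images of the proper ancestors of a node, from the root down: the tuple against which the
    edges of that node are checked. *)
Fixpoint branch (T : Type) (j : nat) : (ctree j -> T) -> ctree j -> seq T :=
  match j return (ctree j -> T) -> ctree j -> seq T with
  | 0 => fun _ _ => [::]
  | j'.+1 => fun (f : option ('I_b * ctree j') -> T) (x : option ('I_b * ctree j')) =>
      if x is Some (a, y) then f None :: branch (fun z => f (Some (a, z))) y else [::]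
  end.

Lemma eq_branch (T : Type) j (f g : ctree j -> T) : f =1 g -> branch f =1 branch g.
Proof.
elim: j f g => [|j IH] f g fg // [[a y]|] //=; rewrite fg; congr cons.
by apply: IH => z; apply: fg.
Qed.

Lemma branch_anc (T : Type) j (f : ctree j -> T) x y z : tanc x y -> x != y ->
  tlevel x < tlevel y /\ nth z (branch f y) (tlevel x) = f x.
Proof.
elim: j f x y => [f []|j IH f [[a x]|] [[a' y]|]] //= /andP[/eqP<- xy] neq.
by have [] := IH (fun z => f (Some (a, z))) x y xy _; first by apply: contraNneq neq => ->.
Qed.

Lemma ancestor_at_level j (y : ctree j) l : l < tlevel y ->
  exists x, [/\ tanc x y, x != y & tlevel x = l].
Proof.
elim: j y l => [[]|j IH [[a y]|]] // [_|l]; first by exists None.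
rewrite /= ltnS => /IH[x [xy neq lx]]; exists (Some (a, x)); split=> //=.
- by rewrite eqxx.
- by apply: contraNneq neq => -[->].
- by rewrite lx.
Qed.

Lemma num_lt j (x : ctree j) : num x < nodes b j.
Proof.
elim: j x => [[]|j IH [[a y]|]] //=; rewrite ltnS.
apply: (@leq_trans (b + b * num y)); first by rewrite ltn_add2r.
by rewrite -mulnS leq_mul2l IH orbT.
Qed.

Lemma leq_digit a m n : a < b -> (b * m <= a + b * n) = (m <= n).
Proof.
move=> ab; have b0 : 0 < b by apply: leq_ltn_trans ab.
apply/idP/idP => [h|mn]; last by apply: leq_trans (leq_addl _ _); rewrite leq_mul2l mn orbT.
rewrite -ltnS -(ltn_pmul2l b0); apply: leq_ltn_trans h _.
by rewrite mulnS ltn_add2r.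
Qed.

Lemma num_inj j : injective (@num j).
Proof.
elim: j => [[]|j IH [[a x]|] [[a' y]|]] //= [E].
have aa' : val a = val a'.
  by have := congr1 (modn^~ b) E; rewrite ![_ + b * _]addnC ![b * _]mulnC !modnMDl !modn_small.
have b0 : 0 < b by apply: leq_ltn_trans (ltn_ord a).
rewrite aa' in E; move/addnI/eqP: E; rewrite eqn_pmul2l // => /eqP/IH->.
by rewrite (val_inj aa').
Qed.

Lemma card_ctree j : #|ctree j| = nodes b j.
Proof.
elim: j => [|j IH]; first by rewrite card_void.
by rewrite card_option card_prod card_ord IH.
Qed.

Definition num_ord j (x : ctree j) : 'I_(nodes b j) := Ordinal (num_lt x).

Lemma num_ord_bij j : bijective (@num_ord j).
Proof.
apply: inj_card_bij => [x y /(congr1 val)/num_inj//|].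
by rewrite card_ctree card_ord.
Qed.

Lemma leq_nodes_num j (x : ctree j) l : 0 < b -> (nodes b l.+1 <= num x) = (l < tlevel x).
Proof.
move=> b0; elim: j x l => [[]|j IH [[a y]|]] // l; rewrite [LHS]ltnS leq_digit //.
by case: l => [|l] //; rewrite IH.
Qed.

Lemma tlevel_lt j (x : ctree j) : tlevel x < j.
Proof. by elim: j x => [[]|j IH [[a y]|]] //=; rewrite ltnS IH. Qed.

Lemma level_num j (x : ctree j) : 0 < b -> level b j (num x) = tlevel x.
Proof.
move=> b0; have lt l : (l < level b j (num x)) = (l < tlevel x).
  rewrite ltn_level leq_nodes_num //; case: (ltnP l (tlevel x)) => [h|]; last by rewrite andbF.
  by rewrite (ltn_trans h (tlevel_lt x)).
apply/eqP; rewrite eqn_leq; apply/andP; split; rewrite leqNgt.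
  by rewrite lt ltnn.
by rewrite -lt ltnn.
Qed.

(** The first step of a path is the least significant digit. If the first steps agree, the
    difference is [b] times that within the subtree; if not, it is not even divisible by [b]. *)
Lemma anc_num j (x y : ctree j) : 0 < b -> anc b j (num x) (num y) = tanc x y.
Proof.
move=> b0; rewrite /anc level_num //.
elim: j x y => [[]|j IH [[a x]|] [[a' y]|]] //=; rewrite ?subn0 ?dvd1n // ltnS subSS.
rewrite -IH; have [<-|neq] := eqVneq a a'.
  by rewrite leq_add2l leq_pmul2l // subnDl -mulnBr expnS dvdn_pmul2l.
apply: contraNF neq => /andP[le dv]; apply/eqP/val_inj => /=.
have : a' + b * num y == a + b * num x %[mod b].
  rewrite eqn_mod_dvd //; apply: dvdn_trans dv; by rewrite expnS dvdn_mulr.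
by rewrite ![_ + b * _]addnC ![b * _]mulnC !modnMDl !modn_small // => /eqP.
Qed.

End CompleteTree.

(** * Homomorphism counts of the family *)

Section CountLabellings.
Variables (Gamma : finType) (b : nat) (c0 : Gamma).
Implicit Types t D : tm Gamma.

Definition leaf : tm Gamma := Node c0 [::] [::].

(* Missing children are read as isolated [leaf]s, so every term labels the
   complete tree. *)
Fixpoint label (j : nat) t : ctree b j -> Gamma * seq nat :=
  match j with
  | 0 => fun _ => (c0, [::])
  | j'.+1 => fun x : option ('I_b * ctree b j') =>
      let: Node c A ch := t in
      if x is Some (a, y) then label (nth leaf ch a) y else (c, A)
  end.

Definition node_ok (G : cgraph Gamma) j t (ctx : seq G) (f : ctree b j -> G) x : bool :=
  root_ok (label t x).1 (label t x).2 (ctx ++ branch f x) (f x).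

Definition label_count (G : cgraph Gamma) j t (ctx : seq G) : nat :=
  #|[set f : {ffun ctree b j -> G} | [forall x, node_ok t ctx f x]]|.

Lemma label_count0 (G : cgraph Gamma) t (ctx : seq G) : label_count 0 t ctx = 1.
Proof.
rewrite /label_count -(card1 ([ffun x : void => match x with end] : {ffun ctree b 0 -> G})).
apply: eq_card => f; rewrite !inE; have -> : [forall x, node_ok t ctx f x] by apply/forallP => -[].
by apply/esym/eqP/ffunP => -[].
Qed.

(** A map on the tree is an image of the root together with independent maps on the [b] subtrees,
    which gives the recursion of [thom] with exactly [b] children. *)
Lemma label_countS (G : cgraph Gamma) j c A ch (ctx : seq G) :
  label_count j.+1 (Node c A ch) ctx =
  \sum_(w : G | root_ok c A ctx w) \prod_(a < b) label_count j (nth leaf ch a) (rcons ctx w).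
Proof.
pose glue (p : G * {ffun 'I_b -> {ffun ctree b j -> G}}) : {ffun ctree b j.+1 -> G} :=
  [ffun x : option ('I_b * ctree b j) => if x is Some (a, y) then p.2 a y else p.1].
pose split_fun (f : {ffun ctree b j.+1 -> G}) : G * {ffun 'I_b -> {ffun ctree b j -> G}} :=
  (f (None : option ('I_b * ctree b j)), [ffun a => [ffun y => f (Some (a, y))]]).
have glueK : cancel glue split_fun.
  case=> w g; rewrite /split_fun ffunE; congr (_, _).
  by apply/ffunP => a; rewrite ffunE; apply/ffunP => y; rewrite !ffunE.
have split_funK : cancel split_fun glue.
  by move=> f; apply/ffunP => -[[a y]|]; rewrite !ffunE /= ?ffunE.
have okE w (g : {ffun 'I_b -> {ffun ctree b j -> G}}) :
    [forall x, node_ok (Node c A ch) ctx (glue (w, g)) x] =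
    root_ok c A ctx w && [forall a : 'I_b, [forall y, node_ok (nth leaf ch a) (rcons ctx w) (g a) y]].
  have okS (a : 'I_b) (y : ctree b j) : node_ok (Node c A ch) ctx (glue (w, g)) (Some (a, y) : ctree b j.+1) =
                 node_ok (nth leaf ch a) (rcons ctx w) (g a) y.
    rewrite /node_ok /= !ffunE cat_rcons.
    by rewrite (@eq_branch _ _ _ _ (g a)) // => z; rewrite ffunE.
  have okN : node_ok (Node c A ch) ctx (glue (w, g)) (None : ctree b j.+1) = root_ok c A ctx w.
    by rewrite /node_ok /= !ffunE cats0.
  apply/forallP/andP => [ok|[okw /forallP okc] [[a y]|]].
  - split; first by rewrite -okN; apply: ok.
    by apply/forallP => a; apply/forallP => y; rewrite -okS; apply: ok.
  - by rewrite okS; apply: (forallP (okc a)).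
  - by rewrite okN.
pose Q (w : G) (a : 'I_b) (h : {ffun ctree b j -> G}) :=
  [forall y, node_ok (nth leaf ch a) (rcons ctx w) h y].
rewrite /label_count -sum1dep_card (reindex glue) /=; last first.
  by apply: onW_bij; exists split_fun.
transitivity (\sum_(p : G * {ffun 'I_b -> {ffun ctree b j -> G}} |
    root_ok c A ctx p.1 && [forall a, Q p.1 a (p.2 a)]) 1).
  by apply: eq_bigl => -[w g]; apply: okE.
rewrite -(pair_big_dep (root_ok c A ctx) 
  (fun w (g : {ffun 'I_b -> {ffun ctree b j -> G}}) => [forall a, Q w a (g a)]) (fun _ _ => 1)) /=.
apply: eq_bigr => w _.
transitivity (\prod_(a < b) \sum_(h | Q w a h) 1); last first.
  by apply: eq_bigr => a _; rewrite sum1dep_card.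
rewrite bigA_distr_big_dep; apply: eq_big => [g|g _]; last by rewrite big1_eq.
by apply/forallP/familyP.
Qed.

Definition colour_count (G : cgraph Gamma) : nat := #|[set w : G | colour G w == c0]|.

Lemma label_count_leaf (G : cgraph Gamma) j (ctx : seq G) :
  label_count j leaf ctx = colour_count G ^ nodes b j.
Proof.
elim: j ctx => [|j IH] ctx; first by rewrite label_count0.
rewrite label_countS (eq_bigr (fun _ => colour_count G ^ (b * nodes b j))); last first.
  move=> w _; rewrite (eq_bigr (fun _ => colour_count G ^ nodes b j)).
    by rewrite prod_nat_const card_ord -expnM mulnC.
  by move=> a _; rewrite nth_nil IH.
rewrite sum_nat_const expnS; congr (_ * _); rewrite /colour_count -!sum1_card.
by apply: eq_bigl => w; rewrite inE unfold_in /root_ok andbT.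
Qed.

(** Each padding node is isolated and contributes an independent factor. Their number depends on the
    shape of [t] alone, so [p] is chosen before the graph. *)
Lemma label_count_thom n j i t : n <= b -> wf n j i t -> exists p,
  forall (G : cgraph Gamma) (ctx : seq G),
    label_count j t ctx = thom t ctx * colour_count G ^ p.
Proof.
move=> nb; elim: j i t => // j IH i [c A ch] /and3P[_ szch wch].
have prodE m (s : seq (tm Gamma)) : all (wf n j i.+1) s -> size s <= m ->
    exists p, forall (G : cgraph Gamma) (ctx : seq G),
    \prod_(a < m) label_count j (nth leaf s a) ctx =
    \prod_(D <- s) thom D ctx * colour_count G ^ p.
  elim: m s => [|m IHm] [|D s] //= ws szm.
  - by exists 0 => G ctx; rewrite big_ord0 big_nil.
  - exists (nodes b j * m.+1) => G ctx; rewrite big_nil mul1n expnM.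
    under eq_bigr do rewrite nth_nil label_count_leaf.
    by rewrite prod_nat_const card_ord.
  case/andP: ws => /IH[p pE] ws; have [q qE] := IHm s ws szm.
  exists (p + q) => G ctx; rewrite big_ord_recl big_cons /= pE qE expnD.
  by rewrite -!mulnA; congr (_ * _); rewrite mulnCA.
have [p pE] := prodE b ch wch (leq_trans szch nb).
exists p => G ctx; rewrite label_countS thomE big_distrl; apply: eq_bigr => w _.
exact: pE.
Qed.

Lemma label_lt n j i t (y : ctree b j) l :
  wf n j i t -> l \in (label t y).2 -> l < i + tlevel y.
Proof.
elim: j i t y => [i t []|j IH] i [c A ch] [[a y]|] /and3P[EA _ wch] /=; last first.
  by rewrite addn0; apply: canon_lt.
rewrite addnS -addSn; case: (ltnP a (size ch)) => [ach|ach].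
  by apply: IH; apply: (allP wch); apply: mem_nth.
rewrite nth_default // => lA; exfalso; move: lA.
suff -> : (label leaf y).2 = [::] by [].
by elim: (j) y => [|j' IHj] // [[a' y]|] //=; rewrite nth_nil.
Qed.

(** The last level is given no children, because [wf] admits no term of height 0. *)
Fixpoint term_of_label (j : nat) : (ctree b j -> Gamma * seq nat) -> tm Gamma :=
  match j return (ctree b j -> Gamma * seq nat) -> tm Gamma with
  | 0 => fun _ => leaf
  | j'.+1 => fun f : option ('I_b * ctree b j') -> Gamma * seq nat =>
      Node (f None).1 (f None).2
        [seq term_of_label (fun y => f (Some (a, y))) |
           a <- if j' is 0 then [::] else enum 'I_b]
  end.

Lemma label_term_of_label j (f : ctree b j -> Gamma * seq nat) :
  label (term_of_label f) =1 f.
Proof.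
elim: j f => [f []|j IH] f [[a y]|] /=; last by case: (f None).
case: j IH f a y => [IH f a []|j] IH f a y.
by rewrite (nth_map a) ?size_enum_ord // nth_ord_enum IH.
Qed.

Lemma wf_term_of_label j i (f : ctree b j -> Gamma * seq nat) : 0 < j ->
  (forall y, (f y).2 == canon (i + tlevel y) (f y).2) ->
  wf b j i (term_of_label f).
Proof.
elim: j i f => // j IH i f _ fA; rewrite /=.
have := fA None; rewrite /= addn0 => -> /=; case: j IH f fA => [|j] IH f fA //.
rewrite size_map size_enum_ord leqnn; apply/allP => _ /mapP[a _ ->].
by apply: IH => // y; have := fA (Some (a, y)); rewrite addSnnS.
Qed.

End CountLabellings.

Section Homomorphisms.
Variables (Gamma : finType) (b k : nat).
Hypotheses (g0 : 0 < #|Gamma|) (b0 : 0 < b) (k0 : 0 < k).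

Definition codes_term (c0 : Gamma) (c : nat) (t : tm Gamma) : Prop :=
  (forall x : ctree b k, tree_colour g0 c (num x) = (label c0 t x).1) /\
  (forall x y : ctree b k, tanc x y -> x != y ->
     edge_bit Gamma b k c (num x) (num y) = (tlevel x \in (label c0 t y).2)).

(** All edges join comparable nodes, so it is enough to check each node against its ancestors, as
    [node_ok] does. *)
Lemma hom_tree_graph n c0 c t (G : cgraph Gamma) : wf n k 0 t -> codes_term c0 c t ->
  hom (tree_graph b k g0 c) G = label_count b c0 k t ([::] : seq G).
Proof.
move=> wt [colE bitE]; have [g numK gK] := num_ord_bij b k.
pose to (h : {ffun ctree b k -> G}) : {ffun tree_graph b k g0 c -> G} :=
  [ffun u => h (g u)].
pose from (f : {ffun tree_graph b k g0 c -> G}) : {ffun ctree b k -> G} :=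
  [ffun x => f (num_ord x)].
rewrite /hom /label_count -!sum1dep_card (reindex to); last first.
  exists from => f _; apply/ffunP => x; rewrite !ffunE.
    by rewrite numK.
  by rewrite gK.
apply: eq_bigl => h; have toE x : to h (num_ord x) = h x by rewrite ffunE numK.
have surj (u : tree_graph b k g0 c) : exists x, u = num_ord x by exists (g u); rewrite gK.
apply/andP/forallP => [[/forallP edges /forallP colours] y|ok].
  apply/andP; split.
    by have := colours (num_ord y); rewrite toE /= colE.
  apply/allP => l lA; have := label_lt wt lA; rewrite add0n => /ancestor_at_level[x [xy neq lx]].
  have [_ E] := branch_anc h (h y) xy neq; rewrite cat0s -lx E.
  have := forallP (edges (num_ord y)) (num_ord x) => /implyP; rewrite !toE; apply.
  rewrite /= /tree_edge (inj_eq (@num_inj b k)) eq_sym neq /= orbC anc_num // xy bitE //.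
  by rewrite lx lA.
have half x y : tanc x y -> x != y -> tlevel x \in (label c0 t y).2 -> edge G (h y) (h x).
  move=> xy neq lA; have /andP[_ /allP/(_ _ lA)] := ok y.
  by have [_ ->] := branch_anc h (h y) xy neq.
split; last first.
  by apply/forallP => u; have [x ->] := surj u; rewrite toE /= colE; have /andP[] := ok x.
apply/forallP => u; apply/forallP => v; have [x ->] := surj u; have [y ->] := surj v.
rewrite !toE /= /tree_edge (inj_eq (@num_inj b k)) !anc_num //; apply/implyP.
case/andP=> neq /orP[|] /andP[xy]; rewrite bitE // 1?eq_sym //.
  by rewrite edge_sym; apply: half.
by apply: half; rewrite 1?eq_sym.
Qed.

Definition code_bound : nat := #|Gamma|.+1 ^ (nodes b k + nodes b k * nodes b k).

Lemma term_has_code c0 t : exists2 c, c < code_bound & codes_term c0 c t.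
Proof.
have [g numK gK] := num_ord_bij b k; set N := nodes b k.
pose col (u : nat) : nat := if insub u is Some u' then enum_rank (label c0 t (g u')).1 else 0.
pose bit (u v : nat) : bool :=
  if (insub u, insub v) is (Some u', Some v')
  then tlevel (g u') \in (label c0 t (g v')).2 else false.
(* Position [N + (u * N + v)] holds the bit of the pair [u], [v], recovered by division with
   remainder. *)
pose F p := if p < N then col p else bit ((p - N) %/ N) ((p - N) %% N).
have FE p : p < N + N * N -> F p < #|Gamma|.+1.
  move=> _; rewrite /F; case: ifP => _; last by rewrite ltnS (leq_trans (leq_b1 _)).
  by rewrite /col; case: insub => // u; rewrite ltnS ltnW.
have insubE (x : ctree b k) : insub (num x) = Some (num_ord x) by rewrite insubT ?num_lt //= => h; congr Some; apply: val_inj.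
have [c cB cE] := digits_exist FE; exists c => //; split.
  move=> x; have xN := num_lt x; apply: enum_rank_inj; apply: val_inj.
  rewrite enum_valK /= cE /F ?xN; last by rewrite ltn_addr.
  by rewrite /col insubE numK modn_small.
move=> x y _ _; have xN := num_lt x; have yN := num_lt y.
rewrite /edge_bit -/N cE.
  rewrite /F [_ < N]ltnNge leq_addr /= addKn divnMDl ?(leq_ltn_trans _ xN) //.
  rewrite (divn_small yN) addn0 modnMDl modn_small //.
  by rewrite /bit !insubE !numK; case: (_ \in _).
rewrite ltn_add2l; apply: (@leq_trans (num x * N + N)); first by rewrite ltn_add2l.
by rewrite addnC -mulSn leq_mul2r xN orbT.
Qed.

Lemma code_has_term c0 c : exists2 t, wf b k 0 t & codes_term c0 c t.
Proof.
pose lvl (y : ctree b k) : seq nat := [seq l <- iota 0 (tlevel y) |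
  [exists x : ctree b k, [&& tanc x y, x != y, tlevel x == l & edge_bit Gamma b k c (num x) (num y)]]].
pose f (y : ctree b k) := (tree_colour g0 c (num y), lvl y).
exists (term_of_label c0 f).
  apply: wf_term_of_label => // y; rewrite add0n /f /=; apply/eqP.
  rewrite /canon; apply: eq_in_filter => l ly.
  by rewrite mem_filter ly andbT.
split=> [x|x y xy neq]; first by rewrite label_term_of_label.
rewrite label_term_of_label /f /lvl mem_filter mem_iota add0n /=.
have [lt nx] := branch_anc id y xy neq; rewrite lt andbT.
apply/idP/existsP => [bxy|[x' /and4P[xy' neq' /eqP lx' bxy]]].
  by exists x; rewrite xy neq eqxx.
(* For the identity, [branch] lists the proper ancestors of [y], so the level determines the
   ancestor and [x'] is [x]. *)
have [_ nx'] := branch_anc id y xy' neq'.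
by rewrite lx' nx in nx'; rewrite /= in nx'; rewrite nx'.
Qed.

Lemma thom_leaf c0 (G : cgraph Gamma) : thom (leaf c0) ([::] : seq G) = colour_count c0 G.
Proof.
rewrite thomE (eq_bigr (fun _ => 1)) => [|w _]; last by rewrite big_nil.
by rewrite sum1dep_card; apply: eq_card => w; rewrite !inE /root_ok andbT.
Qed.

Lemma wf_leaf n (c0 : Gamma) : wf n k 0 (leaf c0).
Proof. by case: k k0. Qed.

(** The family yields term counts only up to a power of a colour count. For a [leaf] the whole
    number is a positive power of that count, so the colour counts agree first and can then be
    cancelled. *)
Lemma hom_tree_graphs_thom (G G' : cgraph Gamma) :
  (forall c, c < code_bound ->
     hom (tree_graph b k g0 c) G = hom (tree_graph b k g0 c) G') ->
  forall t, wf b k 0 t -> thom t ([::] : seq G) = thom t ([::] : seq G').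
Proof.
move=> homE; have termE c0 t : wf b k 0 t -> exists p,
    thom t ([::] : seq G) * colour_count c0 G ^ p = thom t ([::] : seq G') * colour_count c0 G' ^ p.
  move=> wt; have [c cB ct] := term_has_code c0 t.
  have [p pE] := label_count_thom c0 (leqnn b) wt; exists p.
  by rewrite -!pE -!(hom_tree_graph _ wt ct) homE.
have countE c0 : colour_count c0 G = colour_count c0 G'.
  have [p] := termE c0 _ (wf_leaf b c0); rewrite !thom_leaf -!expnS => /eqP.
  by rewrite eqn_exp2r // => /eqP.
(* Padding takes the colour of the root: if no vertex has it, both counts are 0, and otherwise the
   power is positive. *)
move=> t wt; case: t wt => c0 A ch wt; have [p] := termE c0 _ wt.
rewrite countE; case: (posnP (colour_count c0 G')) => [zero _|pos].
  have thom0 (H : cgraph Gamma) : colour_count c0 H = 0 -> thom (Node c0 A ch) ([::] : seq H) = 0.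
    move/eqP; rewrite cards_eq0 => /eqP e; rewrite thomE big1 // => w /andP[cw _].
    by have := in_set0 w; rewrite -e inE cw.
  by rewrite !thom0 ?countE.
by move/eqP; rewrite eqn_pmul2r ?expn_gt0 ?pos // => /eqP.
Qed.

Lemma C_equiv_hom_tree_graph (G G' : cgraph Gamma) c : C_equiv k G G' ->
  hom (tree_graph b k g0 c) G = hom (tree_graph b k g0 c) G'.
Proof.
move=> eqG; have c0 : Gamma := enum_val (Ordinal g0).
have [t wt ct] := code_has_term c0 c.
have [p pE] := label_count_thom c0 (leqnn b) wt.
rewrite !(hom_tree_graph _ wt ct) !pE -!thom_leaf.
by rewrite (C_equiv_thom wt eqG) (C_equiv_thom (wf_leaf 0 c0) eqG).
Qed.

End Homomorphisms.

(** * Computability *)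

Section Computability.

Definition computable (n : nat) (f : seq nat -> nat) : Prop :=
  exists e, forall v, size v = n -> reval e v (f v).

Fixpoint natrec (x : nat) (g : nat -> nat -> nat) (m : nat) : nat :=
  if m is m'.+1 then g m' (natrec x g m') else x.

Variable n : nat.
Implicit Types f g : seq nat -> nat.

Lemma computable_ext f g : computable n f ->
  (forall v, size v = n -> f v = g v) -> computable n g.
Proof. by case=> e ef fg; exists e => v sv; rewrite -fg //; apply: ef. Qed.

Lemma computable_nth i : i < n -> computable n (fun v => nth 0 v i).
Proof. by move=> iN; exists (RProj i) => v sv; apply: reval_proj; rewrite sv. Qed.

Lemma computable_succ f : computable n f -> computable n (fun v => (f v).+1).
Proof.
case=> e ef; exists (RComp RSucc [:: e]) => v sv.
by apply: reval_comp (reval_succ _); constructor; [apply: ef | constructor].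
Qed.

Lemma computable_const c : computable n (fun _ => c).
Proof.
elim: c => [|c IH]; first by exists RZero => v _; constructor.
exact: computable_succ.
Qed.

Lemma revals_proj v (s : seq nat) : all (gtn (size v)) s ->
  revals [seq RProj i | i <- s] v [seq nth 0 v i | i <- s].
Proof.
elim: s => [|i s IH] /=; first by constructor.
by case/andP=> iv /IH rs; constructor=> //; apply: reval_proj.
Qed.

Lemma map_nth_iota (v : seq nat) p : p <= size v ->
  [seq nth 0 v i | i <- iota p (size v - p)] = drop p v.
Proof.
move=> pv; apply: (@eq_from_nth _ 0); rewrite ?size_map ?size_iota ?size_drop // => i ip.
by rewrite (nth_map 0) ?size_iota // nth_iota // nth_drop.
Qed.

(** [RPrec] puts the counter and the previous value in front of the parameters, hence positions 0
    and 1 and the two [behead]s. *)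
Lemma computable_rec a f (g : seq nat -> nat -> nat -> nat) :
  computable n a -> computable n f ->
  computable n.+2 (fun w => g (behead (behead w)) (nth 0 w 0) (nth 0 w 1)) ->
  computable n (fun v => natrec (f v) (g v) (a v)).
Proof.
move=> [ea aE] [ef fE] [eg gE].
exists (RComp (RPrec ef eg) (ea :: [seq RProj i | i <- iota 0 n])) => v sv.
apply: (@reval_comp _ _ _ (a v :: v)).
  constructor; first exact: aE.
  have := @revals_proj v (iota 0 n); have := @map_nth_iota v 0 (leq0n _).
  rewrite subn0 drop0 sv => ->; apply; apply/allP => i; by rewrite mem_iota.
elim: (a v) => [|m IH] /=; first by constructor; apply: fE.
apply: (reval_precS IH); apply: gE; by rewrite /= sv.
Qed.

Lemma computable_lift f : computable n f -> computable n.+1 (fun w => f (behead w)).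
Proof.
case=> e ef; exists (RComp e [seq RProj i | i <- iota 1 n]) => v sv.
apply: (@reval_comp _ _ _ (behead v)); last by apply: ef; rewrite size_behead sv.
have := @revals_proj v (iota 1 n); have := @map_nth_iota v 1.
rewrite sv subn1 drop1 => -> //; apply; apply/allP => i.
by rewrite mem_iota /= add1n => /andP[].
Qed.

End Computability.

Lemma computable_lift2 n f : computable n f ->
  computable n.+2 (fun w => f (behead (behead w))).
Proof. by move=> cf; apply: (computable_lift (computable_lift cf)). Qed.

Lemma computable_add n f g : computable n f -> computable n g ->
  computable n (fun v => f v + g v).
Proof.
move=> cf cg; apply: (@computable_ext n (fun v => natrec (f v) (fun _ r => r.+1) (g v))).
  apply: (computable_rec (g := fun _ _ r => r.+1)) => //.
  by apply: computable_succ; apply: computable_nth.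
by move=> v _; elim: (g v) => [|m /= ->]; rewrite ?addn0 ?addnS.
Qed.

Lemma computable_mul n f g : computable n f -> computable n g ->
  computable n (fun v => f v * g v).
Proof.
move=> cf cg; apply: (@computable_ext n (fun v => natrec 0 (fun _ r => f v + r) (g v))).
  apply: (computable_rec (g := fun v _ r => f v + r)) => //; first exact: computable_const.
  by apply: computable_add; [apply: computable_lift2 | apply: computable_nth].
by move=> v _; elim: (g v) => [|m /= ->]; rewrite ?muln0 ?mulnS.
Qed.

Lemma computable_exp n f g : computable n f -> computable n g ->
  computable n (fun v => f v ^ g v).
Proof.
move=> cf cg; apply: (@computable_ext n (fun v => natrec 1 (fun _ r => f v * r) (g v))).
  apply: (computable_rec (g := fun v _ r => f v * r)) => //; first exact: computable_const.
  by apply: computable_mul; [apply: computable_lift2 | apply: computable_nth].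
by move=> v _; elim: (g v) => [|m /= ->] //; rewrite expnS.
Qed.

Lemma computable_sub n f g : computable n f -> computable n g ->
  computable n (fun v => f v - g v).
Proof.
move=> cf cg.
have pred_natrec m : natrec 0 (fun i _ => i) m = m.-1 by case: m.
apply: (@computable_ext n (fun v => natrec (f v) (fun _ r => natrec 0 (fun i _ => i) r) (g v))).
  apply: (computable_rec (g := fun v _ r => natrec 0 (fun i _ => i) r)) => //.
  apply: (computable_rec (g := fun _ i _ => i)); first exact: computable_nth.
    exact: computable_const.
  exact: computable_nth.
by move=> v _; elim: (g v) => [|m /= ->]; rewrite ?subn0 // pred_natrec subnS.
Qed.

Lemma computable_leq n f g : computable n f -> computable n g ->
  computable n (fun v => f v <= g v).
Proof.
move=> cf cg; apply: (@computable_ext n (fun v => 1 - (f v - g v))).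
  by apply: computable_sub; [apply: computable_const | apply: computable_sub].
by move=> v _; rewrite /leq; case: (f v - g v).
Qed.

Lemma computable_and n (p q : seq nat -> bool) : computable n p -> computable n q ->
  computable n (fun v => p v && q v).
Proof.
by move=> cp /(computable_mul cp)/computable_ext; apply => v _; rewrite mulnb.
Qed.

Lemma computable_not n (p : seq nat -> bool) : computable n p ->
  computable n (fun v => ~~ p v).
Proof.
move=> cp; apply: (@computable_ext n (fun v => 1 - p v)).
  by apply: computable_sub => //; apply: computable_const.
by move=> v _; case: (p v).
Qed.

Lemma computable_or n (p q : seq nat -> bool) : computable n p -> computable n q ->
  computable n (fun v => p v || q v).
Proof.
move=> cp cq; apply: computable_ext (computable_not (computable_and (computable_not cp) (computable_not cq))) _.
by move=> v _; rewrite negb_and !negbK.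
Qed.

Lemma computable_eq n f g : computable n f -> computable n g ->
  computable n (fun v => f v == g v).
Proof.
move=> cf cg; apply: computable_ext (computable_and (computable_leq cf cg) (computable_leq cg cf)) _.
by move=> v _; rewrite eqn_leq.
Qed.

Lemma computable_sum n a (F : seq nat -> nat -> nat) : computable n a ->
  computable n.+2 (fun w => F (behead (behead w)) (nth 0 w 0)) ->
  computable n (fun v => \sum_(i < a v) F v i).
Proof.
move=> ca cF; apply: (@computable_ext n (fun v => natrec 0 (fun i r => r + F v i) (a v))).
  apply: (computable_rec (g := fun v i r => r + F v i)) => //; first exact: computable_const.
  by apply: computable_add => //; apply: computable_nth.
by move=> v _; elim: (a v) => [|m /= ->]; rewrite ?big_ord0 ?big_ord_recr.
Qed.

Lemma sum_ltn x m : x <= m -> \sum_(q < m) (q < x) = x.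
Proof.
elim: m x => [|m IH] x; first by rewrite leqn0 big_ord0 => /eqP.
rewrite big_ord_recr /= leq_eqVlt => /orP[/eqP->|].
  rewrite ltnSn addn1; congr _.+1.
  rewrite (eq_bigr (fun _ => 1)) ?sum_nat_const ?card_ord ?muln1 // => i _.
  by rewrite ltnS ltnW.
by rewrite ltnS => xm; rewrite ltnNge xm addn0; apply: IH.
Qed.

(** Counting the positive multiples of [d] up to [m] makes division a bounded sum, so it is obtained
    by primitive recursion. *)
Lemma divn_sum m d : 0 < d -> m %/ d = \sum_(q < m) (q.+1 * d <= m).
Proof.
move=> d0; rewrite -[LHS](@sum_ltn _ m) ?leq_div //.
by apply: eq_bigr => q _; rewrite -leq_divRL.
Qed.

Lemma computable_div n f g : computable n f -> computable n g ->
  (forall v, 0 < g v) -> computable n (fun v => f v %/ g v).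
Proof.
move=> cf cg g0.
apply: (@computable_ext n (fun v => \sum_(q < f v) (q.+1 * g v <= f v))); last first.
  by move=> v _; rewrite divn_sum.
apply: (computable_sum (F := fun v q => q.+1 * g v <= f v)) => //.
apply: computable_leq; last exact: computable_lift2.
apply: computable_mul; last exact: computable_lift2.
by apply: computable_succ; apply: computable_nth.
Qed.

Lemma computable_mod n f g : computable n f -> computable n g ->
  (forall v, 0 < g v) -> computable n (fun v => f v %% g v).
Proof.
move=> cf cg g0; apply: (@computable_ext n (fun v => f v - f v %/ g v * g v)).
  by apply: computable_sub => //; apply: computable_mul => //; apply: computable_div.
by move=> v _; rewrite {1}(divn_eq (f v) (g v)) addKn.
Qed.

Lemma computable_nodes n fb fk : computable n fb -> computable n fk ->
  computable n (fun v => nodes (fb v) (fk v)).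
Proof.
move=> cb ck; apply: (@computable_ext n (fun v => natrec 0 (fun _ r => (fb v * r).+1) (fk v))).
  apply: (computable_rec (g := fun v _ r => (fb v * r).+1)) => //; first exact: computable_const.
  apply: computable_succ; apply: computable_mul; first exact: computable_lift2.
  exact: computable_nth.
by move=> v _; elim: (fk v) => [|m /= ->].
Qed.

Lemma computable_level n fb fk fu : computable n fb -> computable n fk ->
  computable n fu -> computable n (fun v => level (fb v) (fk v) (fu v)).
Proof.
move=> cb ck cu.
apply: (computable_sum (F := fun v l => nodes (fb v) l.+1 <= fu v)) => //.
apply: computable_leq; last exact: computable_lift2.
apply: computable_nodes; first exact: computable_lift2.
by apply: computable_succ; apply: computable_nth.
Qed.

Lemma computable_anc n fb fk fu fw : computable n fb -> computable n fk ->
  computable n fu -> computable n fw -> (forall v, 0 < fb v) ->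
  computable n (fun v => anc (fb v) (fk v) (fu v) (fw v)).
Proof.
move=> cb ck cu cw b0; apply: computable_and; first exact: computable_leq.
apply: computable_eq; last exact: computable_const.
apply: computable_mod; first exact: computable_sub.
  by apply: computable_exp => //; apply: computable_level.
by move=> v; rewrite expn_gt0 b0.
Qed.

Lemma computable_digit n beta fc fp : computable n fc -> computable n fp ->
  0 < beta -> computable n (fun v => digit beta (fc v) (fp v)).
Proof.
move=> cc cp b0; apply: computable_mod => //; last exact: computable_const.
apply: computable_div => // [|v]; last by rewrite expn_gt0 b0.
by apply: computable_exp => //; apply: computable_const.
Qed.

Lemma computable_edge_bit (Gamma : finType) n fb fk fc fu fw :
  computable n fb -> computable n fk -> computable n fc ->
  computable n fu -> computable n fw ->
  computable n (fun v => edge_bit Gamma (fb v) (fk v) (fc v) (fu v) (fw v)).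
Proof.
move=> cb ck cc cu cw; have cN := computable_nodes cb ck.
apply: computable_leq; first exact: computable_const.
apply: computable_digit => //; apply: computable_add => //; apply: computable_add => //.
exact: computable_mul.
Qed.

Lemma computable_tree_edge (Gamma : finType) n fb fk fc fu fw :
  computable n fb -> computable n fk -> computable n fc ->
  computable n fu -> computable n fw -> (forall v, 0 < fb v) ->
  computable n (fun v => tree_edge Gamma (fb v) (fk v) (fc v) (fu v) (fw v)).
Proof.
move=> cb ck cc cu cw b0; apply: computable_and.
  by apply: computable_not; apply: computable_eq.
by apply: computable_or; apply: computable_and; (apply: computable_anc || apply: computable_edge_bit).
Qed.

(** * Codes of lists and of the graphs of the family *)

Definition code_cons (x m : nat) : nat := 2 ^ x * m.*2.+1.

Lemma codeE s : CodeSeq.code s = foldr code_cons 0 s.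
Proof. by []. Qed.

(** A right fold consumes the list from its end, so step [i] of the recursion treats entry
    [m - i.+1]; the proof is by induction on suffixes. *)
Lemma foldr_code_iota (F : nat -> nat) z m :
  foldr code_cons z [seq F i | i <- iota 0 m] =
  natrec z (fun i r => code_cons (F (m - i.+1)) r) m.
Proof.
suff gen p : p <= m -> foldr code_cons z [seq F i | i <- iota (m - p) p] =
    natrec z (fun i r => code_cons (F (m - i.+1)) r) p.
  by rewrite -gen // subnn.
elim: p => // p IH pm /=; rewrite -IH ?(ltnW pm) // subnSK //.
Qed.

Lemma foldr_code_flatten z (T : Type) (s : seq T) (h : T -> seq nat) :
  foldr code_cons z (flatten (map h s)) =
  foldr (fun x r => foldr code_cons r (h x)) z s.
Proof. by elim: s => //= x s IH; rewrite foldr_cat IH. Qed.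

Lemma foldr_code_allpairs (e : nat -> nat -> nat) z m :
  foldr code_cons z [seq e u v | u <- iota 0 m, v <- iota 0 m] =
  natrec z (fun i r => natrec r (fun i' r' => code_cons (e (m - i.+1) (m - i'.+1)) r') m) m.
Proof.
rewrite foldr_code_flatten.
suff gen p : p <= m -> foldr (fun u r => foldr code_cons r [seq e u v | v <- iota 0 m]) z
      (iota (m - p) p) =
    natrec z (fun i r => natrec r (fun i' r' => code_cons (e (m - i.+1) (m - i'.+1)) r') m) p.
  by rewrite -gen // subnn.
elim: p => // p IH pm /=; rewrite -IH ?(ltnW pm) // subnSK //.
by rewrite foldr_code_iota.
Qed.

Lemma computable_code_cons n f g : computable n f -> computable n g ->
  computable n (fun v => code_cons (f v) (g v)).
Proof.
move=> cf cg; apply: (@computable_ext n (fun v => 2 ^ f v * (g v + g v).+1)); last first.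
  by move=> v _; rewrite /code_cons addnn.
apply: computable_mul; first by apply: computable_exp => //; apply: computable_const.
by apply: computable_succ; apply: computable_add.
Qed.

Lemma computable_code_list n m z (F : seq nat -> nat -> nat) :
  computable n m -> computable n z ->
  computable n.+2 (fun w => F (behead (behead w)) (m (behead (behead w)) - (nth 0 w 0).+1)) ->
  computable n (fun v => foldr code_cons (z v) [seq F v i | i <- iota 0 (m v)]).
Proof.
move=> cm cz cF; apply: (@computable_ext n (fun v =>
    natrec (z v) (fun i r => code_cons (F v (m v - i.+1)) r) (m v))); last first.
  by move=> v _; rewrite foldr_code_iota.
apply: (computable_rec (g := fun v i r => code_cons (F v (m v - i.+1)) r)) => //.
by apply: computable_code_cons => //; apply: computable_nth.
Qed.

Lemma map_enum_ord (T : Type) (F : nat -> T) m :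
  [seq F u | u : 'I_m <- enum 'I_m] = [seq F i | i <- iota 0 m].
Proof. by rewrite -val_enum_ord -map_comp. Qed.

Lemma code_tree_graph (Gamma : finType) b k (g0 : 0 < #|Gamma|) c :
  let N := nodes b k in
  code_graph (tree_graph b k g0 c) =
  code_cons N
   (foldr code_cons
     (foldr code_cons 0 [seq nat_of_bool (tree_edge Gamma b k c u v) | u <- iota 0 N, v <- iota 0 N])
     [seq digit #|Gamma|.+1 c i %% #|Gamma| | i <- iota 0 N]).
Proof.
move=> N; rewrite /code_graph codeE /= card_ord foldr_cat; congr (code_cons _ (foldr _ (foldr _ _ _) _)).
  congr flatten; rewrite -(map_enum_ord (fun u => [seq nat_of_bool (tree_edge Gamma b k c u v) | v <- iota 0 N])).
  by apply: eq_map => u; rewrite -map_enum_ord.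
rewrite -(map_enum_ord (fun i => digit #|Gamma|.+1 c i %% #|Gamma|)).
by apply: eq_map => u; rewrite /= enum_valK.
Qed.

Lemma computable_code_tree_graph (Gamma : finType) n fb fk fc (g0 : 0 < #|Gamma|) :
  computable n fb -> computable n fk -> computable n fc -> (forall v, 0 < fb v) ->
  computable n (fun v => code_graph (tree_graph (fb v) (fk v) g0 (fc v))).
Proof.
move=> cb ck cc b0; pose N v := nodes (fb v) (fk v).
have cN : computable n N by apply: computable_nodes.
pose e v i j : nat := tree_edge Gamma (fb v) (fk v) (fc v) (N v - i.+1) (N v - j.+1).
apply: (@computable_ext n (fun v => code_cons (N v) (foldr code_cons
   (natrec 0 (fun i r => natrec r (fun j r' => code_cons (e v i j) r') (N v)) (N v))
   [seq digit #|Gamma|.+1 (fc v) i %% #|Gamma| | i <- iota 0 (N v)]))); last first.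
  by move=> v _; rewrite code_tree_graph foldr_code_allpairs.
apply: computable_code_cons => //.
apply: (computable_code_list (F := fun v i => digit #|Gamma|.+1 (fc v) i %% #|Gamma|)) => //.
  apply: (computable_rec (g := fun v i r => natrec r (fun j r' => code_cons (e v i j) r') (N v))) => //.
    exact: computable_const.
  apply: (computable_rec (g := fun w j r' => code_cons (e (behead (behead w)) (nth 0 w 0) j) r')).
  - exact: computable_lift2.
  - exact: computable_nth.
  apply: computable_code_cons; last exact: computable_nth.
  (* Two nested recursions put four arguments in front: the inner counter and value, then the outer
     ones. *)
  have lift4 f : computable n f -> computable n.+4 (fun w => f (behead (behead (behead (behead w))))).
    by move=> cf; apply: (computable_lift2 (computable_lift2 cf)).
  apply: computable_tree_edge; rewrite /=; try exact: lift4; try by [].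
    apply: computable_sub; first exact: lift4.
    by apply: computable_succ; apply: (computable_lift2 (f := fun w => nth 0 w 0)); apply: computable_nth.
  apply: computable_sub; first exact: lift4.
  by apply: computable_succ; apply: computable_nth.
apply: computable_mod => //; last exact: computable_const.
apply: computable_digit => //; first exact: computable_lift2.
apply: computable_sub; first exact: computable_lift2.
by apply: computable_succ; apply: computable_nth.
Qed.

Lemma computable_top_bound n fd fk g : computable n fd -> computable n fk ->
  computable n (fun v => top_bound (fd v) (fk v) g).
Proof.
move=> cd ck; have cball : computable n (fun v => ball_bound (fd v) (fk v)).
  apply: computable_exp; first exact: computable_succ.
  by apply: computable_exp => //; apply: computable_const.
have cbranch : computable n (fun v => branch_bound (fd v) (fk v)).
  by apply: computable_add; [apply: computable_mul => //|]; apply: computable_const.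
apply: computable_add => //; apply: computable_exp.
  do 2 apply: computable_succ.
  set N := fun v => ball_bound (fd v) (fk v); set B := fun v => branch_bound (fd v) (fk v).
  apply: (@computable_ext n (fun v => natrec 1 (fun _ r => N v * r ^ B v) (fk v))).
    apply: (computable_rec (g := fun v _ r => N v * r ^ B v)) => //; first exact: computable_const.
    apply: computable_mul; first exact: computable_lift2.
    by apply: computable_exp; [apply: computable_nth | apply: computable_lift2].
  have natrecE M b j : natrec 1 (fun _ r => M * r ^ b) j = thom_bound b M j.
    by elim: j => //= j ->.
  by move=> v _; rewrite natrecE.
set B := fun v => branch_bound (fd v) (fk v).
apply: (@computable_ext n (fun v =>
    natrec 0 (fun _ r => g * (fk v).+1 ^ fk v * r.+1 ^ B v) (fk v))).
  apply: (computable_rec (g := fun v _ r => g * (fk v).+1 ^ fk v * r.+1 ^ B v)) => //.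
    exact: computable_const.
  apply: computable_mul; last first.
    apply: computable_exp; last exact: computable_lift2.
    by apply: computable_succ; apply: computable_nth.
  apply: computable_mul; first exact: computable_const.
  have ck2 := computable_lift2 ck.
  by apply: computable_exp => //; apply: computable_succ.
have natrecE k b j : natrec 0 (fun _ r => g * k.+1 ^ k * r.+1 ^ b) j = terms_bound g b k j.
  by elim: j => //= j ->.
by move=> v _; rewrite natrecE.
Qed.

Theorem theorem22 (Gamma : finType) :
  exists Fam : nat -> nat -> seq (cgraph Gamma),
    computable2 (fun k d => code_graphs (Fam k d)) /\
    forall k d : nat, 1 <= k -> 1 <= d ->
      all (fun F => tree_depth F <= k) (Fam k d) /\
      forall G G' : cgraph Gamma, max_degree G <= d -> max_degree G' <= d ->
        (all (fun F => hom F G == hom F G') (Fam k d) <->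
         C_equiv k G G').
Proof.
(* Without colours there are no terms at all, and the empty family works. *)
case: (posnP #|Gamma|) => [noG|g0].
  exists (fun _ _ => [::]); split; first by exists RZero => m n; constructor.
  move=> k d k0 _; split=> // G G' dG dG'; split=> // _.
  apply: (@bounded_terms_C_equiv _ d) => // -[c A ch].
  by have := card0_eq noG c; rewrite inE.
pose b k d := top_bound d k #|Gamma|.
have b0 k d : 0 < b k d by rewrite /b /top_bound /branch_bound addn_gt0 addnS.
exists (fun k d => [seq tree_graph (b k d) k g0 c |
                     c <- iota 0 (code_bound Gamma (b k d) k)]); split.
  pose fk (v : seq nat) := nth 0 v 0; pose fd (v : seq nat) := nth 0 v 1.
  have ck : computable 2 fk by apply: computable_nth.
  have cd : computable 2 fd by apply: computable_nth.
  have cb : computable 2 (fun v => b (fk v) (fd v)) by apply: computable_top_bound.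
  suff [e eE] : computable 2 (fun v => code_graphs
      [seq tree_graph (b (fk v) (fd v)) (fk v) g0 c |
        c <- iota 0 (code_bound Gamma (b (fk v) (fd v)) (fk v))]).
    by exists e => m n; apply: (eE [:: m; n]).
  pose F v c := code_graph (tree_graph (b (fk v) (fd v)) (fk v) g0 c).
  pose B v := code_bound Gamma (b (fk v) (fd v)) (fk v).
  have cB : computable 2 B.
    have cN := computable_nodes cb ck; apply: computable_exp; first exact: computable_const.
    by apply: computable_add => //; apply: computable_mul.
  apply: (@computable_ext 2 (fun v => foldr code_cons 0 [seq F v i | i <- iota 0 (B v)])).
    apply: computable_code_list => //; first exact: computable_const.
    (* The recursion over the codes adds two arguments to [k] and [d]. *)
    apply: (@computable_code_tree_graph _ 4 (fun w => b (fk (behead (behead w))) (fd (behead (behead w))))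
              (fun w => fk (behead (behead w)))) => //.
    - exact: (computable_lift2 cb).
    - exact: computable_lift2.
    apply: computable_sub; first exact: computable_lift2.
    by apply: computable_succ; apply: computable_nth.
  by move=> v _; rewrite /code_graphs -map_comp.
move=> k d k0 d0; split.
  by rewrite all_map; apply/allP => c _; apply: tree_depth_tree_graph.
move=> G G' dG dG'; rewrite all_map; split=> [/allP homE|eqG].
  apply: (@bounded_terms_C_equiv _ d) => //.
  apply: (hom_tree_graphs_thom (g0 := g0) (b0 k d) k0) => c cB.
  by apply/eqP; apply: homE; rewrite mem_iota.
by apply/allP => c _; apply/eqP; apply: C_equiv_hom_tree_graph.
Qed.
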